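(* (1) Let $d\in\mathbb{N}$. The class of all countable discrete amenable groups all of whose irreducible finite dimensional unitary representations have dimension $\leq d$ is uniformly stable with respect to the family $\{(U(n),d_{HS,n})\}_{n\geq 1}$ of unitary groups with the metrics induced by the normalized Hilbert Schmidt norms. (2) Let $\Gamma$ be a countable discrete amenable group. Then $\Gamma$ is uniformly HS-stable if and only if there exists $d\in\mathbb{N}$ such that all finite dimensional irreducible unitary representations of $\Gamma$ are of dimension $\leq d$.
   Context: For $n\in\mathbb{N}$, $n\geq 1$, the normalized Hilbert Schmidt norm on $M_n(\mathbb{C})$ is $\Vert A\Vert_{HS,n}=\left(\frac1n \mathrm{Tr}(AA^* )\right)^{1/2}=\left(\frac1n\sum_{i,j}|a_{i,j}|^2\right)^{1/2}$, and it induces the bi-invariant metric $d_{HS,n}(U,V)=\Vert U-V\Vert_{HS,n}$ on the unitary group $U(n)$ of $n\times n$ unitary matrices. For a group $G$ and $\epsilon>0$, a map $\varphi:G\to U(n)$ is an $\epsilon$-homomorphism (with respect to $d_{HS,n}$) if $\Vert\varphi(g)\varphi(h)-\varphi(gh)\Vert_{HS,n}<\epsilon$ for all $g,h\in G$. A class $\mathscr{G}$ of groups is uniformly stable with respect to the family $\{(U(n),d_{HS,n})\}_{n\geq1}$ if for every $\delta>0$ there exists $\epsilon>0$ such that for every $G\in\mathscr{G}$, every $n\geq 1$ and every $\epsilon$-homomorphism $\varphi:G\to U(n)$ there is a group homomorphism $\pi:G\to U(n)$ with $\Vert\varphi(g)-\pi(g)\Vert_{HS,n}<\delta$ for all $g\in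 G$ (so $\epsilon$ depends only on $\delta$ and $\mathscr{G}$, not on $G$ or $n$). A single group $\Gamma$ is uniformly HS-stable if the class $\{\Gamma\}$ is uniformly stable with respect to $\{(U(n),d_{HS,n})\}_{n\geq1}$. *)

(* Defs.v *)
From HB Require Import structures.
From mathcomp Require Import all_boot all_order all_algebra.
From mathcomp Require Import complex.
From mathcomp Require Import boolp classical_sets cardinality reals topology normedtype.

Set Implicit Arguments.
Unset Strict Implicit.
Unset Printing Implicit Defensive.

Import Order.TTheory GRing.Theory Num.Theory.
Import numFieldNormedType.Exports.

Local Open Scope classical_set_scope.
Local Open Scope ring_scope.
Local Open Scope sesquilinear_scope.

(* [Re] only casts from R[i] to R: the trace of A A^* is a nonnegative real. *)
Definition hsnorm (R : realType) (n : nat) (A : 'M[R[i]]_n) : R :=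
  Num.sqrt (n%:R^-1 * complex.Re (\tr (A *m A^t*))).

Definition to_unitary (R : realType) (G : groupType) (n : nat)
    (phi : G -> 'M[R[i]]_n) : Prop :=
  forall g, phi g \is unitarymx.

Definition eps_hom (R : realType) (G : groupType) (n : nat) (eps : R)
    (phi : G -> 'M[R[i]]_n) : Prop :=
  to_unitary phi /\
  forall g h : G, hsnorm (phi g *m phi h - phi (g * h)%g) < eps.

(* Group homomorphisms G -> U(n), i.e. unitary representations of G on C^n. *)
Definition unitary_rep (R : realType) (G : groupType) (n : nat)
    (pi : G -> 'M[R[i]]_n) : Prop :=
  to_unitary pi /\ forall g h : G, pi (g * h)%g = pi g *m pi h.

Definition invariant_subspace (R : realType) (G : groupType) (n : nat)
    (pi : G -> 'M[R[i]]_n) (V : {vspace 'cV[R[i]]_n}) : Prop :=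
  forall (g : G) (v : 'cV[R[i]]_n), v \in V -> pi g *m v \in V.

Definition irreducible_rep (R : realType) (G : groupType) (n : nat)
    (pi : G -> 'M[R[i]]_n) : Prop :=
  [/\ (0 < n)%N, unitary_rep pi &
      forall V : {vspace 'cV[R[i]]_n},
        invariant_subspace pi V -> V = 0%VS \/ V = fullv].

Definition irreps_dim_le (R : realType) (G : groupType) (d : nat) : Prop :=
  forall (n : nat) (pi : G -> 'M[R[i]]_n), irreducible_rep pi -> (n <= d)%N.

(* Left-invariant means on the space of bounded real functions on G; the values
   of [m] on unbounded functions are irrelevant. *)
Definition invariant_mean (R : realType) (G : groupType)
    (m : (G -> R) -> R) : Prop :=
  [/\ forall (a : R) (f1 f2 : G -> R), bounded_fun f1 -> bounded_fun f2 ->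
        m (fun x => a * f1 x + f2 x) = a * m f1 + m f2,
      forall f : G -> R, bounded_fun f -> (forall x, 0 <= f x) -> 0 <= m f,
      m (fun=> 1) = 1 &
      forall (g : G) (f : G -> R), bounded_fun f ->
        m (fun x => f (g * x)%g) = m f].

Definition amenable (R : realType) (G : groupType) : Prop :=
  exists m : (G -> R) -> R, invariant_mean m.

Definition uniformly_stable (R : realType) (C : groupType -> Prop) : Prop :=
  forall delta : R, 0 < delta ->
  exists2 eps : R, 0 < eps &
    forall (G : groupType) (n : nat) (phi : G -> 'M[R[i]]_n),
      C G -> (0 < n)%N -> eps_hom eps phi ->
      exists2 pi : G -> 'M[R[i]]_n, unitary_rep pi &
        forall g : G, hsnorm (phi g - pi g) < delta.

Definition uniformly_HS_stable (R : realType) (Gamma : groupType) : Prop :=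
  uniformly_stable R (fun G => G = Gamma).

(* Main.v *)
Require Import Defs.
From mathcomp Require Import all_boot all_order all_algebra.
From mathcomp Require Import ring lra complex.
From mathcomp Require Import boolp classical_sets cardinality filter reals.
From mathcomp Require Import interval_inference topology normedtype.

(** Let [phi : G -> U(n)] be almost multiplicative on an amenable group, with squared
    error [e] in normalised norm. The maps [x |-> phi (x^-1) v], for [v] in [C^n],
    form a copy of [C^n] inside the bounded functions [G -> C^n]; for the inner product
    given by the mean, [G] acts on these functions isometrically by translation, and on
    this copy almost as [phi] does. So [phi] is nearly a corner of a unitary
    representation, and the task is to cut that representation down to about [n]
    dimensions.

    Let [A] be an average of translates of the projection onto the copy of [C^n] whose
    Hilbert-Schmidt norm is almost minimal. By the parallelogram law [A] is
    almost invariant ([averaged_invariant]), and [tr (A - A^2) <= e n] makes it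
    close to a projection. Its spectral projection above a gap between [1/4] and [3/4] therefore
    has rank close to [n], almost contains the copy of [C^n], and is as invariant
    as one likes ([approximate_dilation]): the error of invariance tends to zero while the
    rank stays below [(1 + 4 e) n]. Compressing the translation action to its range
    and passing to a limit along an ultrafilter gives a genuine representation of
    dimension [N <= (1 + 4 e) n] having [phi] nearly as a corner
    ([exact_dilation]). No infinite-dimensional spectral theory enters, since
    every operator in sight has finite rank and is handled through its Gram matrix.

    It remains to correct the dimension from [N] to [n]. If irreducible representations
    have dimension at most [d], there is an invariant subspace of dimension
    between [n - d] and [n] ([invariant_subspace_of_dim]); trivial
    summands fill the rest, and the unitary part of the almost intertwiner carries the result
    to [phi] ([round_corner]). The error [d] is harmless: [N > n] forces
    [4 e n >= 1], hence [d <= 4 d e n]. This proves stability with a bound linear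
    in [e] ([stability_estimate]).

    Conversely, compress an irreducible representation of large dimension [N + 1] to a
    hyperplane and take unitary parts. The multiplicativity error is bounded in
    unnormalised norm, hence small in normalised norm, but a nearby representation of
    dimension [N] would give, by averaging, a nonzero intertwiner into the irreducible one,
    which has no invariant subspace of dimension at most [N] but zero
    ([no_near_intertwiner], [irreps_bounded]). *)

Set Implicit Arguments.
Unset Strict Implicit.
Unset Printing Implicit Defensive.

Import Order.TTheory GRing.Theory Num.Theory.

Local Open Scope ring_scope.
Local Open Scope sesquilinear_scope.

(** * The Hilbert-Schmidt inner product *)

Section Frobenius.
Variable R : realType.
Local Notation C := R[i].

Definition dot m n (A B : 'M[C]_(m, n)) : R := complex.Re (\tr (A *m B^t*)).
Definition sqnorm m n (A : 'M[C]_(m, n)) : R := dot A A.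

Lemma trmxCM m n p (A : 'M[C]_(m, n)) (B : 'M[C]_(n, p)) :
  (A *m B)^t* = B^t* *m A^t*.
Proof. by rewrite trmx_mul map_mxM. Qed.

Lemma trmxCD m n (A B : 'M[C]_(m, n)) : (A + B)^t* = A^t* + B^t*.
Proof. by rewrite raddfD /= map_mxD. Qed.

Lemma trmxCN m n (A : 'M[C]_(m, n)) : (- A)^t* = - A^t*.
Proof. by rewrite raddfN /= map_mxN. Qed.

Lemma trmxC1 n : (1%:M : 'M[C]_n)^t* = 1%:M.
Proof. by rewrite trmx1 map_mx1. Qed.

Lemma trmxC0 m n : (0 : 'M[C]_(m, n))^t* = 0.
Proof. by rewrite trmx0 map_mx0. Qed.

Lemma trmxCZ m n (t : R) (A : 'M[C]_(m, n)) :
  (t%:C%C *: A)^t* = t%:C%C *: A^t*.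
Proof.
apply/matrixP => i j; rewrite !mxE rmorphM /=; congr (_ * _).
exact: conjc_real.
Qed.

Lemma mxtraceC m n (A B : 'M[C]_(m, n)) :
  \tr (A *m B^t*) = Num.conj (\tr (B *m A^t*)).
Proof.
rewrite -[A in LHS]trmxCK -trmxCM /mxtrace raddf_sum /=.
by apply: eq_bigr => i _; rewrite !mxE.
Qed.

Lemma dotC m n (A B : 'M[C]_(m, n)) : dot A B = dot B A.
Proof. by rewrite /dot mxtraceC; case: (\tr _). Qed.

Lemma dotDl m n (A B D : 'M[C]_(m, n)) : dot (A + B) D = dot A D + dot B D.
Proof. by rewrite /dot mulmxDl !raddfD. Qed.

Lemma dotNl m n (A D : 'M[C]_(m, n)) : dot (- A) D = - dot A D.
Proof. by rewrite /dot mulNmx !raddfN. Qed.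

Lemma dotDr m n (A B D : 'M[C]_(m, n)) : dot D (A + B) = dot D A + dot D B.
Proof. by rewrite dotC dotDl !(dotC D). Qed.

Lemma dotNr m n (A D : 'M[C]_(m, n)) : dot D (- A) = - dot D A.
Proof. by rewrite dotC dotNl dotC. Qed.

Lemma dotZl m n (t : R) (A D : 'M[C]_(m, n)) : dot (t%:C%C *: A) D = t * dot A D.
Proof.
rewrite /dot -scalemxAl mxtraceZ; case: (\tr _) => a b /=.
by rewrite mul0r subr0.
Qed.

Lemma dotZr m n (t : R) (A D : 'M[C]_(m, n)) : dot D (t%:C%C *: A) = t * dot D A.
Proof. by rewrite dotC dotZl dotC. Qed.

Lemma dot_mull m n p (X : 'M[C]_(p, m)) (A : 'M[C]_(m, n)) B :
  dot (X *m A) B = dot A (X^t* *m B).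
Proof. by rewrite /dot trmxCM trmxCK -mulmxA mxtrace_mulC mulmxA. Qed.

Lemma dot_mulr m n p (X : 'M[C]_(n, p)) (A : 'M[C]_(m, n)) B :
  dot (A *m X) B = dot A (B *m X^t*).
Proof. by rewrite /dot trmxCM trmxCK mulmxA. Qed.

Lemma dot_adj m n (A B : 'M[C]_(m, n)) : dot (A^t*) (B^t*) = dot A B.
Proof. by rewrite dotC /dot trmxCK mxtrace_mulC. Qed.

Lemma dotE m n (A B : 'M[C]_(m, n)) :
  dot A B = \sum_i \sum_j
    (complex.Re (A i j) * complex.Re (B i j) + complex.Im (A i j) * complex.Im (B i j)).
Proof.
rewrite /dot /mxtrace raddf_sum /=; apply: eq_bigr => i _.
rewrite !mxE raddf_sum /=; apply: eq_bigr => j _; rewrite !mxE.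
by case: (A i j) => a b; case: (B i j) => c d /=; rewrite mulrN opprK.
Qed.

Lemma sqE m n (A : 'M[C]_(m, n)) :
  sqnorm A = \sum_i \sum_j (complex.Re (A i j) ^+ 2 + complex.Im (A i j) ^+ 2).
Proof. by rewrite /sqnorm dotE. Qed.

Lemma sq_ge0 m n (A : 'M[C]_(m, n)) : 0 <= sqnorm A.
Proof.
rewrite sqE; apply: sumr_ge0 => i _; apply: sumr_ge0 => j _.
by rewrite addr_ge0 ?sqr_ge0.
Qed.

Lemma dotxx m n (A : 'M[C]_(m, n)) : dot A A = sqnorm A.
Proof. by []. Qed.

Lemma dot0l m n (A : 'M[C]_(m, n)) : dot 0 A = 0.
Proof. by rewrite /dot mul0mx mxtrace0. Qed.

Lemma sq0 m n : sqnorm (0 : 'M[C]_(m, n)) = 0.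
Proof. by rewrite /sqnorm /dot mul0mx mxtrace0. Qed.

Lemma sq_eq0 m n (A : 'M[C]_(m, n)) : sqnorm A = 0 -> A = 0.
Proof.
move=> A0; apply/matrixP => i j; rewrite mxE.
have p1 k l : 0 <= complex.Re (A k l) ^+ 2 + complex.Im (A k l) ^+ 2.
  by rewrite addr_ge0 ?sqr_ge0.
have := A0; rewrite sqE => /eqP; rewrite psumr_eq0; last first.
  by move=> k _; apply: sumr_ge0.
move/allP/(_ i (mem_index_enum _)) => /=; rewrite psumr_eq0 //.
move/allP/(_ j (mem_index_enum _)) => /=; rewrite paddr_eq0 ?sqr_ge0 //.
rewrite !sqrf_eq0 => /andP[/eqP a0 /eqP b0].
by apply/eqP; rewrite eq_complex a0 b0 /= eqxx.
Qed.

Lemma sq_adj m n (A : 'M[C]_(m, n)) : sqnorm (A^t*) = sqnorm A.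
Proof. exact: dot_adj. Qed.

Lemma sqN m n (A : 'M[C]_(m, n)) : sqnorm (- A) = sqnorm A.
Proof. by rewrite /sqnorm dotNl dotNr opprK. Qed.

Lemma sqD m n (A B : 'M[C]_(m, n)) : sqnorm (A + B) = sqnorm A + sqnorm B + 2 * dot A B.
Proof.
rewrite /sqnorm dotDl !dotDr (dotC B A).
by move: (dot A A) (dot B B) (dot A B) => a b c; ring.
Qed.

Lemma sqB m n (A B : 'M[C]_(m, n)) : sqnorm (A - B) = sqnorm A + sqnorm B - 2 * dot A B.
Proof. by rewrite sqD sqN dotNr mulrN. Qed.

Lemma sqZ m n (t : R) (A : 'M[C]_(m, n)) : sqnorm (t%:C%C *: A) = t ^+ 2 * sqnorm A.
Proof. by rewrite /sqnorm dotZl dotZr mulrA. Qed.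

Lemma sqD_le m n (A B : 'M[C]_(m, n)) : sqnorm (A + B) <= 2 * (sqnorm A + sqnorm B).
Proof.
have := sq_ge0 (A - B); rewrite sqB sqD.
by move: (sqnorm A) (sqnorm B) (dot A B) => a b c; lra.
Qed.

Lemma sqB_le m n (A B : 'M[C]_(m, n)) : sqnorm (A - B) <= 2 * (sqnorm A + sqnorm B).
Proof. by have := sqD_le A (- B); rewrite sqN. Qed.

Lemma sqD3_le m n (A B D : 'M[C]_(m, n)) :
  sqnorm (A + B + D) <= 3 * (sqnorm A + sqnorm B + sqnorm D).
Proof.
have := sq_ge0 (A - B); have := sq_ge0 (A - D); have := sq_ge0 (B - D).
rewrite !sqB !sqD dotDl.
move: (sqnorm A) (sqnorm B) (sqnorm D) (dot A B) (dot A D) (dot B D) => *; lra.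
Qed.

(** Young's form of Cauchy-Schwarz, free of square roots. *)
Lemma dot_le m n (A B : 'M[C]_(m, n)) : 2 * dot A B <= sqnorm A + sqnorm B.
Proof.
have := sq_ge0 (A - B); rewrite sqB.
by move: (sqnorm A) (sqnorm B) (dot A B) => a b c; lra.
Qed.

Lemma sq_row_mx m n1 n2 (A : 'M[C]_(m, n1)) (B : 'M[C]_(m, n2)) :
  sqnorm (row_mx A B) = sqnorm A + sqnorm B.
Proof.
rewrite !sqE -big_split; apply: eq_bigr => i _.
rewrite big_split_ord /=; congr (_ + _); apply: eq_bigr => j _.
  by rewrite row_mxEl.
by rewrite row_mxEr.
Qed.

Lemma sq_col_mx m1 m2 n (A : 'M[C]_(m1, n)) (B : 'M[C]_(m2, n)) :
  sqnorm (col_mx A B) = sqnorm A + sqnorm B.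
Proof.
by rewrite -sq_adj tr_col_mx map_row_mx sq_row_mx !sq_adj.
Qed.

Lemma sq1 n : sqnorm (1%:M : 'M[C]_n) = n%:R.
Proof.
rewrite /sqnorm /dot trmxC1 mulmx1 mxtrace1.
by rewrite -[n%:R in LHS](rmorph_nat (real_complex R)).
Qed.

Lemma sq_isom m n p (S : 'M[C]_(m, n)) (A : 'M[C]_(n, p)) :
  S^t* *m S = 1%:M -> sqnorm (S *m A) = sqnorm A.
Proof. by move=> SS; rewrite /sqnorm dot_mull mulmxA SS mul1mx. Qed.

Lemma sq_isomr m n p (S : 'M[C]_(n, p)) (A : 'M[C]_(m, n)) :
  S *m S^t* = 1%:M -> sqnorm (A *m S) = sqnorm A.
Proof. by move=> SS; rewrite /sqnorm dot_mulr -mulmxA SS mulmx1. Qed.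

Lemma sq_isometry m n (S : 'M[C]_(m, n)) : S^t* *m S = 1%:M -> sqnorm S = n%:R.
Proof. by move=> SS; rewrite -[S]mulmx1 sq_isom // sq1. Qed.

Lemma unitary_ctr n (U : 'M[C]_n) : U \is unitarymx -> U *m U^t* = 1%:M.
Proof. by move/unitarymxP. Qed.

Lemma unitary_ctl n (U : 'M[C]_n) : U \is unitarymx -> U^t* *m U = 1%:M.
Proof.
by rewrite -trmxC_unitary => /unitarymxP; rewrite trmxCK.
Qed.

End Frobenius.

(** * Means of matrix-valued functions *)

Section Mean.
Variables (R : realType) (T : Type).
Local Notation C := R[i].

Definition bnd (f : T -> R) := exists K, forall x, `|f x| <= K.

Definition mean (m : (T -> R) -> R) : Prop :=
  [/\ forall (a : R) (f1 f2 : T -> R), bnd f1 -> bnd f2 ->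
        m (fun x => a * f1 x + f2 x) = a * m f1 + m f2,
      forall f : T -> R, bnd f -> (forall x, 0 <= f x) -> 0 <= m f &
      m (fun=> 1) = 1].

Lemma bnd_cst c : bnd (fun=> c).
Proof. by exists `|c|. Qed.

Lemma bndD f g : bnd f -> bnd g -> bnd (fun x => f x + g x).
Proof.
move=> [K fK] [L gL]; exists (K + L) => x.
by rewrite (le_trans (ler_normD _ _)) ?lerD.
Qed.

Lemma bndM f g : bnd f -> bnd g -> bnd (fun x => f x * g x).
Proof.
move=> [K fK] [L gL]; exists (K * L) => x.
by rewrite normrM ler_pM.
Qed.

Lemma bndN f : bnd f -> bnd (fun x => - f x).
Proof. by move=> [K fK]; exists K => x; rewrite normrN. Qed.

Definition cbnd (f : T -> C) :=
  bnd (fun x => complex.Re (f x)) /\ bnd (fun x => complex.Im (f x)).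

Lemma re_mul (a b : C) : complex.Re (a * b) =
  complex.Re a * complex.Re b - complex.Im a * complex.Im b.
Proof. by case: a; case: b. Qed.

Lemma im_mul (a b : C) : complex.Im (a * b) =
  complex.Re a * complex.Im b + complex.Im a * complex.Re b.
Proof. by case: a; case: b. Qed.

Lemma re_conj (a : C) : complex.Re (Num.conj a) = complex.Re a.
Proof. by case: a. Qed.

Lemma im_conj (a : C) : complex.Im (Num.conj a) = - complex.Im a.
Proof. by case: a. Qed.

Lemma cbnd_cst c : cbnd (fun=> c).
Proof. by split; exact: bnd_cst. Qed.

Lemma cbndD f g : cbnd f -> cbnd g -> cbnd (fun x => f x + g x).
Proof.
by move=> [f1 f2] [g1 g2]; split; under eq_fun do rewrite raddfD; exact: bndD.
Qed.

Lemma cbndN f : cbnd f -> cbnd (fun x => - f x).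
Proof.
by move=> [f1 f2]; split; under eq_fun do rewrite raddfN; exact: bndN.
Qed.

Lemma cbndM f g : cbnd f -> cbnd g -> cbnd (fun x => f x * g x).
Proof.
move=> [f1 f2] [g1 g2]; split.
  by under eq_fun do rewrite re_mul; apply: bndD; [|apply: bndN]; exact: bndM.
by under eq_fun do rewrite im_mul; apply: bndD; exact: bndM.
Qed.

Lemma cbndC f : cbnd f -> cbnd (fun x => Num.conj (f x)).
Proof.
move=> [f1 f2]; split; first by under eq_fun do rewrite re_conj.
by under eq_fun do rewrite im_conj; exact: bndN.
Qed.

Lemma cbnd_sum (I : Type) (r : seq I) (f : I -> T -> C) :
  (forall i, cbnd (f i)) -> cbnd (fun x => \sum_(i <- r) f i x).
Proof.
move=> fb; elim: r => [|i r IH].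
  by under eq_fun do rewrite big_nil; exact: cbnd_cst.
by under eq_fun do rewrite big_cons; exact: cbndD.
Qed.

Definition mbnd p q (F : T -> 'M[C]_(p, q)) := forall i j, cbnd (fun x => F x i j).

Lemma mbnd_cst p q (A : 'M[C]_(p, q)) : mbnd (fun=> A).
Proof. by move=> i j; exact: cbnd_cst. Qed.

Lemma mbndD p q (F F' : T -> 'M[C]_(p, q)) :
  mbnd F -> mbnd F' -> mbnd (fun x => F x + F' x).
Proof. by move=> Fb F'b i j; under eq_fun do rewrite mxE; exact: cbndD. Qed.

Lemma mbndN p q (F : T -> 'M[C]_(p, q)) : mbnd F -> mbnd (fun x => - F x).
Proof. by move=> Fb i j; under eq_fun do rewrite mxE; exact: cbndN. Qed.

Lemma mbndB p q (F F' : T -> 'M[C]_(p, q)) :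
  mbnd F -> mbnd F' -> mbnd (fun x => F x - F' x).
Proof. by move=> Fb F'b; apply: mbndD => //; exact: mbndN. Qed.

Lemma mbndZ p q c (F : T -> 'M[C]_(p, q)) : mbnd F -> mbnd (fun x => c *: F x).
Proof.
move=> Fb i j; under eq_fun do rewrite mxE.
by apply: cbndM => //; exact: cbnd_cst.
Qed.

Lemma mbndM p q r (F : T -> 'M[C]_(p, q)) (F' : T -> 'M[C]_(q, r)) :
  mbnd F -> mbnd F' -> mbnd (fun x => F x *m F' x).
Proof.
move=> Fb F'b i j; under eq_fun do rewrite mxE.
by apply: cbnd_sum => k; exact: cbndM.
Qed.

Lemma mbndMc p q r (F : T -> 'M[C]_(p, q)) (A : 'M[C]_(q, r)) :
  mbnd F -> mbnd (fun x => F x *m A).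
Proof. by move=> Fb; apply: mbndM => //; exact: mbnd_cst. Qed.

Lemma mbndC p q (F : T -> 'M[C]_(p, q)) : mbnd F -> mbnd (fun x => (F x)^t*).
Proof. by move=> Fb i j; under eq_fun do rewrite !mxE; exact: cbndC. Qed.

Lemma mbnd_row_mx p q r (F : T -> 'M[C]_(p, q)) (F' : T -> 'M[C]_(p, r)) :
  mbnd F -> mbnd F' -> mbnd (fun x => row_mx (F x) (F' x)).
Proof.
move=> Fb F'b i j; rewrite -(splitK j); case: (split j) => k /=.
  by under eq_fun do rewrite row_mxEl; exact: Fb.
by under eq_fun do rewrite row_mxEr; exact: F'b.
Qed.

Lemma mbnd_dot p q (F F' : T -> 'M[C]_(p, q)) :
  mbnd F -> mbnd F' -> bnd (fun x => dot (F x) (F' x)).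
Proof.
move=> Fb F'b; have [i _] : cbnd (fun x => \tr (F x *m (F' x)^t*)).
  by apply: cbnd_sum => i; apply: mbndM => //; exact: mbndC.
exact: i.
Qed.

Lemma mbnd_sq p q (F : T -> 'M[C]_(p, q)) : mbnd F -> bnd (fun x => sqnorm (F x)).
Proof. by move=> Fb; exact: mbnd_dot. Qed.

Lemma sq_mbnd p q K (F : T -> 'M[C]_(p, q)) : (forall x, sqnorm (F x) <= K) -> mbnd F.
Proof.
move=> FK i j.
have H x : complex.Re (F x i j) ^+ 2 + complex.Im (F x i j) ^+ 2 <= K.
  apply: le_trans (FK x); rewrite sqE (bigD1 i) //= (bigD1 j) //=.
  rewrite -addrA lerDl addr_ge0 // sumr_ge0 // => k _.
    by rewrite addr_ge0 ?sqr_ge0.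
  by rewrite sumr_ge0 // => l _; rewrite addr_ge0 ?sqr_ge0.
have sqK (a : R) : a ^+ 2 <= K -> `|a| <= K + 1.
  rewrite -real_normK ?num_real //; have := normr_ge0 a.
  by move: (`|a|) => b b0 bK; nra.
by split; exists (K + 1) => x; apply: sqK; apply: le_trans (H x);
  rewrite ?lerDl ?lerDr sqr_ge0.
Qed.

Section WithMean.
Variables (m : (T -> R) -> R) (mP : mean m).

Lemma meanD f g : bnd f -> bnd g -> m (fun x => f x + g x) = m f + m g.
Proof.
move=> fb gb; case: mP => lin _ _.
have := lin 1 f g fb gb; rewrite mul1r => <-.
by congr m; apply/funext => x; rewrite mul1r.
Qed.

Lemma mean0 : m (fun=> 0) = 0.
Proof.
have := meanD (bnd_cst 0) (bnd_cst 0); rewrite (_ : (fun=> 0 + 0) = fun=> 0); last first.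
  by apply/funext => x; rewrite addr0.
by move/eqP; rewrite -subr_eq0 opprD addrA subrr sub0r oppr_eq0 => /eqP.
Qed.

Lemma meanZ a f : bnd f -> m (fun x => a * f x) = a * m f.
Proof.
move=> fb; case: mP => lin _ _.
have := lin a f _ fb (bnd_cst 0); rewrite mean0 addr0 => <-.
by congr m; apply/funext => x; rewrite addr0.
Qed.

Lemma meanN f : bnd f -> m (fun x => - f x) = - m f.
Proof.
move=> fb; rewrite -mulN1r -meanZ //; congr m; apply/funext => x.
by rewrite mulN1r.
Qed.

Lemma mean_cst c : m (fun=> c) = c.
Proof.
case: mP => _ _ m1; rewrite -[RHS]mulr1 -[X in _ = _ * X]m1 -meanZ.
  by congr m; apply/funext => x; rewrite mulr1.
exact: bnd_cst.
Qed.

Lemma mean_ge0 f : bnd f -> (forall x, 0 <= f x) -> 0 <= m f.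
Proof. by case: mP => _ pos _; exact: pos. Qed.

Lemma mean_le f g : bnd f -> bnd g -> (forall x, f x <= g x) -> m f <= m g.
Proof.
move=> fb gb fg; rewrite -subr_ge0 -meanN // -meanD //; last exact: bndN.
apply: mean_ge0 => [|x]; last by rewrite subr_ge0.
by apply: bndD => //; exact: bndN.
Qed.

Definition cmean (f : T -> C) : C :=
  Complex (m (fun x => complex.Re (f x))) (m (fun x => complex.Im (f x))).

Lemma cmeanD f g : cbnd f -> cbnd g ->
  cmean (fun x => f x + g x) = cmean f + cmean g.
Proof.
move=> [f1 f2] [g1 g2]; rewrite /cmean; apply/eqP.
rewrite eq_complex /= -!meanD //; apply/andP; split; apply/eqP; congr m;
  by apply/funext => x; rewrite raddfD.
Qed.

Lemma cmeanZ c f : cbnd f -> cmean (fun x => c * f x) = c * cmean f.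
Proof.
move=> [f1 f2]; apply/eqP; rewrite eq_complex re_mul im_mul /=; apply/andP; split; apply/eqP.
  rewrite -!meanZ // -meanN -?meanD; last 3 first.
  - by apply: bndM => //; exact: bnd_cst.
  - by apply: bndN; apply: bndM => //; exact: bnd_cst.
  - by apply: bndM => //; exact: bnd_cst.
  by congr m; apply/funext => x; rewrite re_mul.
rewrite -!meanZ // -?meanD; last 2 first.
- by apply: bndM => //; exact: bnd_cst.
- by apply: bndM => //; exact: bnd_cst.
by congr m; apply/funext => x; rewrite im_mul.
Qed.

Lemma cmeanC f : cbnd f -> cmean (fun x => Num.conj (f x)) = Num.conj (cmean f).
Proof.
move=> [f1 f2]; apply/eqP; rewrite eq_complex re_conj im_conj /= -meanN //.
by apply/andP; split; apply/eqP; congr m; apply/funext => x; rewrite ?re_conj ?im_conj.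
Qed.

Lemma cmean_cst c : cmean (fun=> c) = c.
Proof. by rewrite /cmean !mean_cst; case: c. Qed.

Lemma cmean_sum (I : Type) (r : seq I) (f : I -> T -> C) :
  (forall i, cbnd (f i)) ->
  cmean (fun x => \sum_(i <- r) f i x) = \sum_(i <- r) cmean (f i).
Proof.
move=> fb; elim: r => [|i r IH].
  by rewrite big_nil; under eq_fun do rewrite big_nil; exact: cmean_cst.
rewrite big_cons -IH -cmeanD //; last exact: cbnd_sum.
by congr cmean; apply/funext => x; rewrite big_cons.
Qed.

Definition mxmean p q (F : T -> 'M[C]_(p, q)) : 'M[C]_(p, q) :=
  \matrix_(i, j) cmean (fun x => F x i j).

Lemma mxmeanD p q (F F' : T -> 'M[C]_(p, q)) : mbnd F -> mbnd F' ->
  mxmean (fun x => F x + F' x) = mxmean F + mxmean F'.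
Proof.
move=> Fb F'b; apply/matrixP => i j; rewrite !mxE -cmeanD //.
by congr cmean; apply/funext => x; rewrite mxE.
Qed.

Lemma mxmean_mull p q r (A : 'M[C]_(r, p)) (F : T -> 'M[C]_(p, q)) : mbnd F ->
  mxmean (fun x => A *m F x) = A *m mxmean F.
Proof.
move=> Fb; apply/matrixP => i j; rewrite !mxE.
under eq_fun do rewrite mxE.
rewrite cmean_sum => [|k]; last by apply: cbndM => //; exact: cbnd_cst.
by apply: eq_bigr => k _; rewrite cmeanZ ?mxE.
Qed.

Lemma mxmeanC p q (F : T -> 'M[C]_(p, q)) : mbnd F ->
  mxmean (fun x => (F x)^t*) = (mxmean F)^t*.
Proof.
move=> Fb; apply/matrixP => i j; rewrite !mxE.
under eq_fun do rewrite !mxE.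
by rewrite cmeanC.
Qed.

Lemma mxmean_mulr p q r (A : 'M[C]_(q, r)) (F : T -> 'M[C]_(p, q)) : mbnd F ->
  mxmean (fun x => F x *m A) = mxmean F *m A.
Proof.
move=> Fb; rewrite -[LHS]trmxCK -mxmeanC; last exact: mbndMc.
under eq_fun do rewrite trmxCM.
by rewrite mxmean_mull ?mxmeanC ?trmxCM ?trmxCK //; exact: mbndC.
Qed.

Lemma mxmean_cst p q (A : 'M[C]_(p, q)) : mxmean (fun=> A) = A.
Proof. by apply/matrixP => i j; rewrite !mxE cmean_cst. Qed.

Lemma mxmean_dot p q (F : T -> 'M[C]_(p, q)) A : mbnd F ->
  dot (mxmean F) A = m (fun x => dot (F x) A).
Proof.
move=> Fb; rewrite /dot -mxmean_mulr // /mxtrace.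
have FAb := mbndMc (A^t*) Fb.
under eq_bigr do rewrite mxE.
by rewrite -cmean_sum.
Qed.

(** A bounded function with values in the [n] by [p] matrices is read as a [p]-tuple of
    vectors of the pre-Hilbert space of bounded functions [T -> C^n]; entry [(i, j)] of
    [gram F F'] is the inner product of the [i]-th with the [j]-th. *)
Definition gram n p q (F : T -> 'M[C]_(n, p)) (F' : T -> 'M[C]_(n, q)) :
  'M[C]_(p, q) := mxmean (fun x => (F x)^t* *m F' x).

Definition meansq n p (F : T -> 'M[C]_(n, p)) : R := m (fun x => sqnorm (F x)).

Lemma innC n p q (F : T -> 'M[C]_(n, p)) (F' : T -> 'M[C]_(n, q)) :
  mbnd F -> mbnd F' -> (gram F F')^t* = gram F' F.
Proof.
move=> Fb F'b; rewrite -mxmeanC; last by apply: mbndM => //; exact: mbndC.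
by congr mxmean; apply/funext => x; rewrite trmxCM trmxCK.
Qed.

Lemma innMr n p q r (F : T -> 'M[C]_(n, p)) (F' : T -> 'M[C]_(n, q)) (A : 'M[C]_(q, r)) :
  mbnd F -> mbnd F' -> gram F (fun x => F' x *m A) = gram F F' *m A.
Proof.
move=> Fb F'b; rewrite -mxmean_mulr; last by apply: mbndM => //; exact: mbndC.
by congr mxmean; apply/funext => x; rewrite mulmxA.
Qed.

Lemma innMl n p q r (F : T -> 'M[C]_(n, p)) (F' : T -> 'M[C]_(n, q)) (A : 'M[C]_(p, r)) :
  mbnd F -> mbnd F' -> gram (fun x => F x *m A) F' = A^t* *m gram F F'.
Proof.
move=> Fb F'b; rewrite -mxmean_mull; last by apply: mbndM => //; exact: mbndC.
by congr mxmean; apply/funext => x; rewrite trmxCM mulmxA.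
Qed.

Lemma innDr n p q (F : T -> 'M[C]_(n, p)) (F1 F2 : T -> 'M[C]_(n, q)) :
  mbnd F -> mbnd F1 -> mbnd F2 ->
  gram F (fun x => F1 x + F2 x) = gram F F1 + gram F F2.
Proof.
move=> Fb F1b F2b; rewrite -mxmeanD; last 2 first.
- by apply: mbndM => //; exact: mbndC.
- by apply: mbndM => //; exact: mbndC.
by congr mxmean; apply/funext => x; rewrite mulmxDr.
Qed.

Lemma innNr n p q (F : T -> 'M[C]_(n, p)) (F' : T -> 'M[C]_(n, q)) :
  mbnd F -> mbnd F' -> gram F (fun x => - F' x) = - gram F F'.
Proof.
move=> Fb F'b.
have -> : - gram F F' = gram F F' *m (- 1%:M) by rewrite mulmxN mulmx1.
rewrite -(innMr (- 1%:M) Fb F'b); congr (gram _ _).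
by apply/funext => x; rewrite mulmxN mulmx1.
Qed.

Lemma innBr n p q (F : T -> 'M[C]_(n, p)) (F1 F2 : T -> 'M[C]_(n, q)) :
  mbnd F -> mbnd F1 -> mbnd F2 ->
  gram F (fun x => F1 x - F2 x) = gram F F1 - gram F F2.
Proof. by move=> Fb F1b F2b; rewrite innDr ?innNr //; exact: mbndN. Qed.

Lemma hsq_ge0 n p (F : T -> 'M[C]_(n, p)) : mbnd F -> 0 <= meansq F.
Proof.
by move=> Fb; apply: mean_ge0 => [|x]; [exact: mbnd_sq|exact: sq_ge0].
Qed.

Lemma dot_inn n p q (F : T -> 'M[C]_(n, p)) (F' : T -> 'M[C]_(n, q)) A :
  mbnd F -> mbnd F' -> dot (gram F F') A = m (fun x => dot (F' x) (F x *m A)).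
Proof.
move=> Fb F'b; rewrite mxmean_dot; last by apply: mbndM => //; exact: mbndC.
by congr m; apply/funext => x; rewrite dot_mull trmxCK.
Qed.

Lemma hsq_inn n p (F : T -> 'M[C]_(n, p)) : mbnd F -> meansq F = dot (gram F F) 1%:M.
Proof.
move=> Fb; rewrite (dot_inn _ Fb Fb); congr m; apply/funext => x.
by rewrite mulmx1.
Qed.

(** Bessel's inequality and all comparisons with orthogonal projections are instances
    of this identity. *)
Lemma hsq_sub n p q (Y : T -> 'M[C]_(n, p)) (F : T -> 'M[C]_(n, q)) c :
  mbnd Y -> mbnd F ->
  meansq (fun x => F x - Y x *m c) =
  meansq F - 2 * dot (gram Y F) c + dot (gram Y Y *m c) c.
Proof.
move=> Yb Fb; have Ycb := mbndMc c Yb.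
rewrite -(innMr c Yb Yb) !dot_inn // /meansq.
rewrite -meanZ -?meanN -?meanD; try by repeat first
  [exact: bnd_cst | exact: mbnd_dot | exact: mbnd_sq | apply: bndM | apply: bndN | apply: bndD].
congr m; apply/funext => x; rewrite sqB /sqnorm.
by move: (dot _ _) (dot _ _) (dot _ _) => a b d; ring.
Qed.

Lemma bessel n p q (Y : T -> 'M[C]_(n, p)) (F : T -> 'M[C]_(n, q)) :
  mbnd Y -> mbnd F -> gram Y Y = 1%:M -> sqnorm (gram Y F) <= meansq F.
Proof.
move=> Yb Fb YY.
have := hsq_ge0 (mbndB Fb (mbndMc (gram Y F) Yb)).
rewrite hsq_sub // YY mul1mx -/(sqnorm _).
by move: (sqnorm _) (meansq F) => a b; lra.
Qed.

Lemma hsq_proj n p q (Y : T -> 'M[C]_(n, p)) (F : T -> 'M[C]_(n, q)) :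
  mbnd Y -> mbnd F -> gram Y Y = 1%:M ->
  meansq (fun x => F x - Y x *m gram Y F) = meansq F - sqnorm (gram Y F).
Proof.
move=> Yb Fb YY; rewrite hsq_sub // YY mul1mx -/(sqnorm _).
by move: (sqnorm _) (meansq F) => a b; ring.
Qed.

(** Bounded functions form only a pre-Hilbert space, in which nonzero null vectors
    exist; subtracting large multiples of them shows that they are harmless. *)
Lemma inn_null n p q (Y : T -> 'M[C]_(n, p)) (F : T -> 'M[C]_(n, q)) :
  mbnd Y -> mbnd F -> gram Y Y = 0 -> gram Y F = 0.
Proof.
move=> Yb Fb YY; apply: sq_eq0; apply/eqP; rewrite eq_le sq_ge0 andbT.
have H (t : R) : 2 * t * sqnorm (gram Y F) <= meansq F.
  have := hsq_ge0 (mbndB Fb (mbndMc (t%:C%C *: gram Y F) Yb)).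
  rewrite hsq_sub // YY mul0mx dotZr -/(sqnorm _) [dot 0 _]/dot mul0mx mxtrace0 /=.
  by move: (sqnorm _) (meansq F) => a b; lra.
rewrite leNgt; apply/negP => Q0.
have := H (meansq F / sqnorm (gram Y F)); rewrite -mulrA divfK ?gt_eqF //.
have := H 1; move: Q0; move: (sqnorm _) (meansq F) => a b; lra.
Qed.

End WithMean.
End Mean.

(** * Averages of translated projections *)

Section MeanBlocks.
Opaque sqnorm dot.
Variables (R : realType) (T : Type) (m : (T -> R) -> R) (mP : mean m).
Local Notation C := R[i].
Local Notation inn := (gram m).

Lemma inn_row_mxr n p q r (F : T -> 'M[C]_(n, p)) (F1 : T -> 'M[C]_(n, q))
    (F2 : T -> 'M[C]_(n, r)) :
  inn F (fun x => row_mx (F1 x) (F2 x)) = row_mx (inn F F1) (inn F F2).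
Proof.
apply/matrixP => i j; rewrite -(splitK j); case: (split j) => k /=.
  rewrite row_mxEl !mxE; congr cmean; apply/funext => x.
  by rewrite mul_mx_row row_mxEl.
rewrite row_mxEr !mxE; congr cmean; apply/funext => x.
by rewrite mul_mx_row row_mxEr.
Qed.

Lemma inn_row_mxl n p q r (F : T -> 'M[C]_(n, p)) (F1 : T -> 'M[C]_(n, q))
    (F2 : T -> 'M[C]_(n, r)) : mbnd F -> mbnd F1 -> mbnd F2 ->
  inn (fun x => row_mx (F1 x) (F2 x)) F = col_mx (inn F1 F) (inn F2 F).
Proof.
move=> Fb F1b F2b; rewrite -innC //; last exact: mbnd_row_mx.
by rewrite inn_row_mxr tr_row_mx map_col_mx !innC.
Qed.

Lemma innZr n p q (t : R) (F : T -> 'M[C]_(n, p)) (F' : T -> 'M[C]_(n, q)) :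
  mbnd F -> mbnd F' -> inn F (fun x => t%:C%C *: F' x) = t%:C%C *: inn F F'.
Proof.
move=> Fb F'b; rewrite -mul_mx_scalar -(innMr mP _ Fb F'b).
by congr (mxmean _ _); apply/funext => x; rewrite mul_mx_scalar.
Qed.

Lemma innZl n p q (t : R) (F : T -> 'M[C]_(n, p)) (F' : T -> 'M[C]_(n, q)) :
  mbnd F -> mbnd F' -> inn (fun x => t%:C%C *: F x) F' = t%:C%C *: inn F F'.
Proof.
move=> Fb F'b; rewrite -(innC mP) //; last exact: mbndZ.
by rewrite innZr // trmxCZ innC.
Qed.

Lemma hsqZ n p (t : R) (F : T -> 'M[C]_(n, p)) : mbnd F ->
  meansq m (fun x => t%:C%C *: F x) = t ^+ 2 * meansq m F.
Proof.
move=> Fb; rewrite -(meanZ mP); last exact: mbnd_sq.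
by congr m; apply/funext => x; rewrite sqZ.
Qed.

Lemma hsq_row_mx n p q (F1 : T -> 'M[C]_(n, p)) (F2 : T -> 'M[C]_(n, q)) :
  mbnd F1 -> mbnd F2 ->
  meansq m (fun x => row_mx (F1 x) (F2 x)) = meansq m F1 + meansq m F2.
Proof.
move=> F1b F2b; rewrite -(meanD mP); try exact: mbnd_sq.
by congr m; apply/funext => x; rewrite sq_row_mx.
Qed.

End MeanBlocks.

Section Translates.
Variables (R : realType) (G : groupType) (m : (G -> R) -> R) (mP : mean m).
Hypothesis minv : forall (g : G) (f : G -> R), bnd f -> m (fun x => f (g * x)%g) = m f.
Local Notation C := R[i].
Local Notation inn := (gram m).
Local Notation hsq := (meansq m).

Definition translate n p (g : G) (F : G -> 'M[C]_(n, p)) x := F (g^-1 * x)%g.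

Lemma translateE n p g (F : G -> 'M[C]_(n, p)) x : translate g F x = F (g^-1 * x)%g.
Proof. by []. Qed.

Lemma translateMr n p q g (F : G -> 'M[C]_(n, p)) (A : 'M[C]_(p, q)) :
  translate g (fun x => F x *m A) = fun x => translate g F x *m A.
Proof. by []. Qed.

Lemma mbnd_translate n p g (F : G -> 'M[C]_(n, p)) : mbnd F -> mbnd (translate g F).
Proof.
move=> Fb i j; have [[K FK] [L FL]] := Fb i j.
by split; [exists K|exists L] => x; [exact: FK|exact: FL].
Qed.

Lemma translateM n p g h (F : G -> 'M[C]_(n, p)) :
  translate g (translate h F) = translate (g * h)%g F.
Proof. by apply/funext => x; rewrite /translate invgM mulgA. Qed.

Lemma translate1 n p (F : G -> 'M[C]_(n, p)) : translate 1%g F = F.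
Proof. by apply/funext => x; rewrite /translate invg1 mul1g. Qed.

Lemma mxmean_translate p q g (F : G -> 'M[C]_(p, q)) : mbnd F ->
  mxmean m (fun x => F (g * x)%g) = mxmean m F.
Proof.
move=> Fb; apply/matrixP => i j; have [H1 H2] := Fb i j.
rewrite [LHS]mxE [RHS]mxE /cmean.
by apply: f_equal2; [exact: (minv g H1)|exact: (minv g H2)].
Qed.

Lemma inn_translate n p q g (F : G -> 'M[C]_(n, p)) (F' : G -> 'M[C]_(n, q)) :
  mbnd F -> mbnd F' -> inn (translate g F) (translate g F') = inn F F'.
Proof.
by move=> Fb F'b; exact: (mxmean_translate g^-1%g (mbndM (mbndC Fb) F'b)).
Qed.

Lemma inn_translatel n p q g (F : G -> 'M[C]_(n, p)) (F' : G -> 'M[C]_(n, q)) :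
  mbnd F -> mbnd F' -> inn (translate g F) F' = inn F (translate g^-1%g F').
Proof.
move=> Fb F'b; rewrite -(inn_translate g^-1%g (mbnd_translate g Fb) F'b) translateM.
by rewrite mulVg translate1; reflexivity.
Qed.

Lemma hsq_translate n p g (F : G -> 'M[C]_(n, p)) : mbnd F -> hsq (translate g F) = hsq F.
Proof. by move=> Fb; rewrite !(hsq_inn mP) ?inn_translate //; exact: mbnd_translate. Qed.

Section Orbit.
Opaque sqnorm dot cmean meansq mxmean gram translate.
Variables (n : nat) (phi : G -> 'M[C]_n) (e : R).
Hypothesis phiU : forall g, phi g \is unitarymx.
Hypothesis phie : forall g h, sqnorm (phi g *m phi h - phi (g * h)%g) <= e * n%:R.

(** The columns of [orb g] are the functions [x |-> phi (x^-1 g) v]; for an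
    exact homomorphism they would be [orb 1] times [phi g]. *)
Definition orb (g : G) : G -> 'M[C]_n := fun x => phi (x^-1 * g)%g.

Lemma translate_orb g h : translate g (orb h) = orb (g * h)%g.
Proof. by apply/funext => x; rewrite translateE /orb invgM invgK !mulgA. Qed.

Lemma orb_isometry g x : (orb g x)^t* *m orb g x = 1%:M.
Proof. exact/unitary_ctl/phiU. Qed.

Lemma mbnd_orb g : mbnd (orb g).
Proof.
apply: (@sq_mbnd _ _ _ _ n%:R) => x.
by rewrite sq_isometry //; exact: orb_isometry.
Qed.

Lemma inn_orb1 : inn (orb 1%g) (orb 1%g) = 1%:M.
Proof.
rewrite -[RHS](mxmean_cst mP); congr (mxmean _ _); apply/funext => x.
exact: orb_isometry.
Qed.

Lemma hsq_orb g : hsq (orb g) = n%:R.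
Proof.
rewrite -[RHS](mean_cst mP); congr m; apply/funext => x.
by rewrite sq_isometry //; exact: orb_isometry.
Qed.

Lemma hsq_orb_defect g :
  hsq (fun x => orb g x - orb 1%g x *m phi g) <= e * n%:R.
Proof.
rewrite -[leRHS](mean_cst mP); apply: (mean_le mP).
- apply: mbnd_sq; apply: mbndB; first exact: mbnd_orb.
  by apply: mbndMc; exact: mbnd_orb.
- exact: bnd_cst.
move=> x; rewrite -sqN opprB; apply: le_trans (phie _ _).
by rewrite /orb mulg1.
Qed.

Let c := (1 - e) * n%:R.

(** The Gram matrix of [orb 1] and [orb g] is the matrix nearest to intertwining them, so
    it does at least as well as the unitary matrix [phi g]. *)
Lemma inn_orb_ge g h : c <= sqnorm (inn (orb g) (orb h)).
Proof.
have -> : inn (orb g) (orb h) = inn (orb 1%g) (orb (g^-1 * h)%g).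
  rewrite -(inn_translate g (mbnd_orb 1%g) (mbnd_orb (g^-1 * h)%g)) !translate_orb mulg1.
  by rewrite mulVKg.
move: (g^-1 * h)%g => {h}g.
have := hsq_orb_defect g.
have -> := hsq_sub mP (phi g) (mbnd_orb 1) (mbnd_orb g).
rewrite inn_orb1 mul1mx dotxx hsq_orb sq_isometry ?unitary_ctl //.
have := dot_le (inn (orb 1%g) (orb g)) (phi g).
rewrite [sqnorm (phi g)]sq_isometry ?unitary_ctl // /c.
move: (sqnorm _) (dot _ _) (n%:R) => a b d; lra.
Qed.

(** The columns of [B] stand for the finite-rank operator [A = B B^*]. What is kept of
    its being an average of translates of the projection onto the span of [orb 1] is:
    trace [n], [A <= 1], and a large overlap of [A] with each of these translates
    and with each translate of [A] itself. *)
Definition averaged p (B : G -> 'M[C]_(n, p)) : Prop :=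
  [/\ mbnd B, hsq B = n%:R,
      forall q (F : G -> 'M[C]_(n, q)), mbnd F -> sqnorm (inn B F) <= hsq F,
      forall g, c <= sqnorm (inn (orb g) B) &
      forall g, c <= sqnorm (inn B (translate g B))].

Lemma averaged_orb : averaged (orb 1%g).
Proof.
split.
- exact: mbnd_orb.
- exact: hsq_orb.
- by move=> q F Fb; apply: bessel => //; [exact: mbnd_orb|exact: inn_orb1].
- by move=> g; exact: inn_orb_ge.
- by move=> g; rewrite translate_orb; exact: inn_orb_ge.
Qed.

(** The average of the operators of [B] and of its translate: summing operators
    means juxtaposing columns. *)
Definition midpoint p (g : G) (B : G -> 'M[C]_(n, p)) : G -> 'M[C]_(n, p + p) :=
  fun x => (Num.sqrt 2^-1)%:C%C *: row_mx (B x) (translate g B x).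

Let s2 : Num.sqrt 2^-1 ^+ 2 = 2^-1 :> R.
Proof. by rewrite sqr_sqrtr // invr_ge0. Qed.

Lemma mbnd_midpoint p g (B : G -> 'M[C]_(n, p)) : mbnd B -> mbnd (midpoint g B).
Proof. by move=> Bb; apply/mbndZ/mbnd_row_mx => //; exact: mbnd_translate. Qed.

Lemma sq_inn_midpoint p q g (B : G -> 'M[C]_(n, p)) (F : G -> 'M[C]_(n, q)) :
  mbnd B -> mbnd F ->
  sqnorm (inn (midpoint g B) F) = 2^-1 * (sqnorm (inn B F) + sqnorm (inn (translate g B) F)).
Proof.
move=> Bb Fb; have sBb := mbnd_translate g Bb.
by rewrite innZl ?inn_row_mxl ?sqZ ?s2 ?sq_col_mx //; exact: mbnd_row_mx.
Qed.

Lemma sq_innC p q (F : G -> 'M[C]_(n, p)) (F' : G -> 'M[C]_(n, q)) :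
  mbnd F -> mbnd F' -> sqnorm (inn F F') = sqnorm (inn F' F).
Proof. by move=> Fb F'b; rewrite -sq_adj innC. Qed.

Lemma translate_midpoint p g h (B : G -> 'M[C]_(n, p)) :
  translate h (midpoint g B) =
  (fun x => (Num.sqrt 2^-1)%:C%C *: row_mx (translate h B x) (translate (h * g) B x)).
Proof. by apply/funext => x; rewrite /midpoint !translateE invgM mulgA. Qed.

Lemma sq_inn_midpointr p q g h (B : G -> 'M[C]_(n, p)) (F : G -> 'M[C]_(n, q)) :
  mbnd B -> mbnd F ->
  sqnorm (inn F (translate h (midpoint g B))) =
  2^-1 * (sqnorm (inn F (translate h B)) + sqnorm (inn F (translate (h * g)%g B))).
Proof.
move=> Bb Fb; have sb k := mbnd_translate k Bb.
rewrite translate_midpoint (innZr mP _ Fb (mbnd_row_mx (sb h) (sb (h * g)%g))).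
by rewrite inn_row_mxr sqZ s2 sq_row_mx.
Qed.

Lemma sq_inn_translate_midpoint p g h (B : G -> 'M[C]_(n, p)) : mbnd B ->
  sqnorm (inn (midpoint g B) (translate h (midpoint g B))) =
  4^-1 * (sqnorm (inn B (translate h B)) + sqnorm (inn B (translate (h * g)%g B)) +
    (sqnorm (inn B (translate (g^-1 * h)%g B)) + sqnorm (inn B (translate (g^-1 * (h * g))%g B)))).
Proof.
move=> Bb; have sb k := mbnd_translate k Bb.
rewrite (sq_inn_midpointr _ _ Bb (mbnd_midpoint g Bb)).
rewrite (sq_inn_midpoint g Bb (sb h)) (sq_inn_midpoint g Bb (sb (h * g)%g)).
rewrite (inn_translatel g Bb (sb h)) (inn_translatel g Bb (sb (h * g)%g)) !translateM.
have avg (a1 a2 a3 a4 : R) :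
  2^-1 * (2^-1 * (a1 + a3) + 2^-1 * (a2 + a4)) = 4^-1 * (a1 + a2 + (a3 + a4)).
  by lra.
exact: avg.
Qed.

Lemma averaged_midpoint p g (B : G -> 'M[C]_(n, p)) :
  averaged B -> averaged (midpoint g B).
Proof.
move=> [Bb BT BF Bo Bs]; have sb k := mbnd_translate k Bb.
split.
- exact: mbnd_midpoint.
- rewrite hsqZ //; last exact: mbnd_row_mx.
  rewrite hsq_row_mx // hsq_translate // BT s2; lra.
- move=> q F Fb; rewrite (sq_inn_midpoint g Bb Fb) (inn_translatel g Bb Fb).
  have avg (a1 a2 a3 : R) : a1 <= a3 -> a2 <= a3 -> 2^-1 * (a1 + a2) <= a3 by lra.
  apply: avg; first exact: BF.
  by rewrite -(hsq_translate g^-1%g Fb); apply: BF; exact: mbnd_translate.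
- move=> h; have ob := mbnd_orb.
  rewrite (sq_innC (ob h) (mbnd_midpoint g Bb)) (sq_inn_midpoint g Bb (ob h)).
  rewrite (inn_translatel g Bb (ob h)) translate_orb !(sq_innC Bb (ob _)).
  have avg (a1 a2 : R) : c <= a1 -> c <= a2 -> c <= 2^-1 * (a1 + a2) by lra.
  by apply: avg; exact: Bo.
- move=> h; rewrite (sq_inn_translate_midpoint _ _ Bb).
  have avg (a1 a2 a3 a4 : R) : c <= a1 -> c <= a2 -> c <= a3 -> c <= a4 ->
    c <= 4^-1 * (a1 + a2 + (a3 + a4)) by lra.
  by apply: avg; exact: Bs.
Qed.

(** By the parallelogram law, an average of almost minimal Hilbert-Schmidt norm
    is almost invariant, as its midpoint with a translate is again an average. *)
Lemma averaged_invariant eta : 0 < eta ->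
  exists p (B : G -> 'M[C]_(n, p)), averaged B /\
    forall g, sqnorm (inn B B) - 2 * eta <= sqnorm (inn B (translate g B)).
Proof.
move=> eta0.
have close (x a b b' i : R) : x = 4^-1 * (a + b + (b' + a)) -> b' = b ->
  i <= x -> a < i + eta -> a - 2 * eta <= b by lra.
pose S := [set r | exists p (B : G -> 'M[C]_(n, p)),
  averaged B /\ r = sqnorm (inn B B)]%classic.
have infS : has_inf S.
  split.
    exists (sqnorm (inn (orb 1%g) (orb 1%g))), n, (orb 1%g); split => //.
    exact: averaged_orb.
  by exists 0 => _ [p [B [_ ->]]]; exact: sq_ge0.
have [_ [p [B [BA ->]]] Blt] := inf_adherent eta0 infS.
exists p, B; split => // g.
have [Bb _ _ _ _] := BA.
have infB : inf S <= sqnorm (inn (midpoint g B) (midpoint g B)).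
  apply: ge_inf; first by case: infS.
  by exists (p + p)%N, (midpoint g B); split => //; exact: averaged_midpoint.
have mid := sq_inn_translate_midpoint g 1%g Bb.
rewrite translate1 mul1g mulg1 mulVg translate1 in mid.
have sym : sqnorm (inn B (translate g^-1%g B)) = sqnorm (inn B (translate g B)).
  by rewrite -(inn_translatel g Bb Bb); exact: sq_innC (mbnd_translate g Bb) Bb.
exact: close mid sym infB Blt.
Qed.

End Orbit.
End Translates.

(** * Gaps in the spectrum *)

Section Spectrum.
Variable R : realType.

(** At most [4 n] of the eigenvalues exceed [1/4], so they cannot meet all of the [4 n + 1]
    windows into which an interval of length [1/2] above [1/4] is divided. The width of
    the gap depends on [n] alone, not on the number [p] of eigenvalues. *)
Lemma eigenvalue_gap p (n : nat) (a : 'I_p -> R) : (forall i, 0 <= a i) ->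
  \sum_i a i = n%:R ->
  exists s t : R, [/\ 4^-1 <= s, s < t, t <= 3 / 4,
     2 * (4 * n + 1)%:R * (t - s) = 1 &
     forall i, a i <= s \/ t <= a i].
Proof.
move=> a0 an; set J := (4 * n + 1)%N.
have J0 : 0 < J%:R :> R by rewrite ltr0n /J addn1.
pose w : R := (2 * J%:R)^-1.
have wJ : w * J%:R = 2^-1 by rewrite /w invfM -mulrA mulVf ?mulr1 // gt_eqF.
have w0 : 0 < w by rewrite invr_gt0 mulr_gt0.
pose u k : R := 4^-1 + w * k%:R.
have u4 k : 4^-1 <= u k by rewrite lerDl mulr_ge0 // ltW.
have uS k : u k.+1 = u k + w by rewrite /u -[k.+1%:R]natr1 mulrDr mulr1 addrA.
have u_mono k l : (k <= l)%N -> u k <= u l.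
  by move=> kl; rewrite lerD2l ler_pM2l ?ler_nat.
case: (pselect (exists k : 'I_J, forall i, a i <= u k \/ u k.+1 <= a i)).
  move=> [k ka]; exists (u k), (u k.+1); split => //.
  - by rewrite uS ltrDl.
  - apply: le_trans (u_mono _ _ (ltn_ord k)) _; rewrite /u wJ; lra.
  - rewrite uS (_ : u k + w - u k = w); last by rewrite addrAC subrr add0r.
    by rewrite -mulrA [_ * w]mulrC wJ mulfV ?pnatr_eq0.
move/forallNP => noGap.
have pick (k : 'I_J) : exists i, u k < a i < u k.+1.
  have [i /not_orP[/negP + /negP]] := (existsNP _).2 (noGap k).
  by rewrite -!ltNge => h1 h2; exists i; apply/andP.
have [f fP] := choice pick.
have f_inj : injective f.
  move=> k l kl; apply/val_inj/eqP; rewrite eqn_leq.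
  have /andP[k1 k2] := fP k; have /andP[l1 l2] := fP l.
  rewrite kl in k1 k2.
  apply/andP; split; rewrite leqNgt; apply/negP => /u_mono.
    by move=> h; have := lt_trans k1 (lt_le_trans l2 h); rewrite ltxx.
  by move=> h; have := lt_trans l1 (lt_le_trans k2 h); rewrite ltxx.
have : \sum_(k < J) (4^-1 : R) <= \sum_i a i.
  apply: (@le_trans _ _ (\sum_(k < J) a (f k))).
    apply: ler_sum => k _; have /andP[k1 _] := fP k.
    exact: le_trans (u4 k) (ltW k1).
  have -> : \sum_(k < J) a (f k) = \sum_(i in [set f x | x in [set: 'I_J]]%SET) a i.
    rewrite big_imset => [|? ? _ _]; last exact: f_inj.
    by apply: eq_bigl => x; rewrite inE.
  rewrite [leRHS](bigID (mem [set f x | x in [set: 'I_J]]%SET)) /=.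
  by rewrite lerDl sumr_ge0.
rewrite an sumr_const card_ord /J -[X in X <= _]mulr_natr natrD natrM.
by move: (n%:R : R) => b; lra.
Qed.

(** Here [x i j] is the squared inner product of the [i]-th eigenvector with the
    translate of the [j]-th one, and [sum a_i a_j x_ij] is the overlap of [A] with
    its translate. Twice the overlap defect equals
    [sum (a_i - a_j)^2 x_ij + sum a_i^2 (1 - r_i) + sum a_j^2 (1 - c_j)] with row
    sums [r] and column sums [c], all terms nonnegative; across the gap
    [(a_i - a_j)^2 >= (t - s)^2], which controls how much of a translated
    large eigenvector leaves the span of the large ones. *)
Lemma gap_estimate p (a : 'I_p -> R) (x : 'I_p -> 'I_p -> R) (s t eta : R) :
  (forall i j, 0 <= x i j) ->
  (forall i, \sum_j x i j <= 1) -> (forall j, \sum_i x i j <= 1) ->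
  \sum_i a i ^+ 2 - 2 * eta <= \sum_i \sum_j a i * a j * x i j ->
  4^-1 <= s -> s < t -> (forall i, a i <= s \/ t <= a i) ->
  \sum_(i | t <= a i) 1 - \sum_(i | t <= a i) \sum_(j | t <= a j) x i j
    <= (64 + 4 / (t - s) ^+ 2) * eta.
Proof.
move=> x0 rx cx inv s4 st gap.
pose r i := \sum_j x i j; pose c j := \sum_i x i j.
pose D1 := \sum_i a i ^+ 2 * (1 - r i).
pose D2 := \sum_j a j ^+ 2 * (1 - c j).
pose D3 := \sum_i \sum_j (a i - a j) ^+ 2 * x i j.
have eqD : D1 + D2 + D3 =
    2 * (\sum_i a i ^+ 2 - \sum_i \sum_j a i * a j * x i j).
  have -> : D1 = \sum_i a i ^+ 2 - \sum_i \sum_j a i ^+ 2 * x i j.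
    rewrite -sumrB; apply: eq_bigr => i _.
    by rewrite mulrBr mulr1 mulr_sumr.
  have -> : D2 = \sum_i a i ^+ 2 - \sum_i \sum_j a j ^+ 2 * x i j.
    rewrite exchange_big -sumrB; apply: eq_bigr => i _.
    by rewrite mulrBr mulr1 mulr_sumr.
  have -> : D3 = \sum_i \sum_j a i ^+ 2 * x i j + \sum_i \sum_j a j ^+ 2 * x i j
     - 2 * \sum_i \sum_j a i * a j * x i j.
    rewrite mulr_sumr -big_split /= -sumrB; apply: eq_bigr => i _.
    rewrite mulr_sumr -big_split /= -sumrB; apply: eq_bigr => j _.
    by move: (a i) (a j) (x i j) => b d y; ring.
  by move: (\sum_i _) (\sum_i _) (\sum_i _) (\sum_i _) => b1 b2 b3 b4; ring.
have D10 : 0 <= D1 by apply: sumr_ge0 => i _; rewrite mulr_ge0 ?sqr_ge0 ?subr_ge0 ?rx.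
have D20 : 0 <= D2 by apply: sumr_ge0 => i _; rewrite mulr_ge0 ?sqr_ge0 ?subr_ge0 ?cx.
have D30 : 0 <= D3.
  by apply: sumr_ge0 => i _; apply: sumr_ge0 => j _; rewrite mulr_ge0 ?sqr_ge0.
pose L := \sum_(i | t <= a i) (1 - r i).
pose K := \sum_(i | t <= a i) \sum_(j | ~~ (t <= a j)) x i j.
have -> : \sum_(i | t <= a i) 1 - \sum_(i | t <= a i) \sum_(j | t <= a j) x i j = L + K.
  rewrite -sumrB -big_split; apply: eq_bigr => i _ /=.
  rewrite /r (bigID (fun j => t <= a j) predT) /=.
  by move: (\sum_(j | _) _) (\sum_(j | _) _) => b d; ring.
have LD : L <= 16 * D1.
  rewrite /L big_mkcond mulr_sumr; apply: ler_sum => i _.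
  have ri : 0 <= 1 - r i by rewrite subr_ge0 rx.
  case: ifP => [ta|_]; last by rewrite mulr_ge0 // mulr_ge0 ?sqr_ge0.
  have : 1 <= 16 * a i ^+ 2 by nra.
  by rewrite mulrA => /(ler_wpM2r ri); rewrite mul1r.
have g0 : 0 < (t - s) ^+ 2 by rewrite exprn_gt0 // subr_gt0.
have KD : (t - s) ^+ 2 * K <= D3.
  rewrite /K big_mkcond mulr_sumr; apply: ler_sum => i _.
  case: ifP => [ta|_]; last first.
    by rewrite mulr0 sumr_ge0 // => j _; rewrite mulr_ge0 ?sqr_ge0.
  rewrite big_mkcond mulr_sumr; apply: ler_sum => j _.
  case: ifP => [/negP tj|_]; last by rewrite mulr0 mulr_ge0 ?sqr_ge0.
  apply: ler_wpM2r => //.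
  have aj : a j <= s by case: (gap j).
  have h0 : 0 <= t - s by move: (st); clear; lra.
  have h1 : t - s <= a i - a j by move: aj ta; clear; lra.
  by rewrite !expr2 ler_pM.
have D1e : D1 <= 4 * eta by move: eqD inv D20 D30; clear; lra.
have D3e : K <= 4 / (t - s) ^+ 2 * eta.
  have : (t - s) ^+ 2 * K <= 4 * eta by move: eqD inv D10 D20 KD; clear; lra.
  by rewrite mulrC -ler_pdivlMr // mulrAC.
rewrite mulrDl; move: LD D1e D3e; clear; lra.
Qed.

Section Truncation.
Variables (p : nat) (a : 'I_p -> R) (N e : R) (s t : R).
Hypotheses (a0 : forall i, 0 <= a i) (a1 : forall i, a i <= 1).
Hypotheses (sumN : \sum_i a i = N) (sum2N : (1 - e) * N <= \sum_i a i ^+ 2).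
Hypotheses (s4 : 4^-1 <= s) (st : s < t) (t4 : t <= 3 / 4) (gap : forall i, a i <= s \/ t <= a i).

(* Where [1/4 <= s < t <= 3/4], the distance from [a i] to its truncation, 0 or 1,
   is at most [4 a (1 - a)]. *)
Let defect : \sum_i 4 * (a i * (1 - a i)) <= 4 * e * N.
Proof.
rewrite -mulr_sumr (eq_bigr (fun i => a i - a i ^+ 2)) => [|i _]; last first.
  by rewrite mulrBr mulr1.
rewrite sumrB sumN; move: sum2N; move: (\sum_i _) => b; lra.
Qed.

Lemma count_large : \sum_(i | t <= a i) 1 <= (1 + 4 * e) * N.
Proof.
have : \sum_(i | t <= a i) 1 <= \sum_i a i + \sum_i 4 * (a i * (1 - a i)).
  rewrite big_mkcond -big_split; apply: ler_sum => i _ /=.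
  have b0 := a0 i; have b1 := a1 i; case: ifP => tb.
    have : 0 <= (1 - a i) * (4 * a i - 1).
      by rewrite mulr_ge0 ?subr_ge0 //; have := s4; have := st; move: tb; lra.
    by move: (a i) => b; lra.
  rewrite addr_ge0 // mulr_ge0 // mulr_ge0 ?subr_ge0 //.
move/le_trans; apply; rewrite sumN mulrDl mul1r.
by rewrite lerD2l.
Qed.

Lemma sum_small : \sum_(i | ~~ (t <= a i)) a i <= 4 * e * N.
Proof.
apply: le_trans defect; rewrite big_mkcond; apply: ler_sum => i _.
have b0 := a0 i; have b1 := a1 i; case: ifP => [/negP tb|_]; last first.
  by rewrite mulr_ge0 // mulr_ge0 ?subr_ge0.
have bs : a i <= s by case: (gap i).
have : 0 <= a i * (3 - 4 * a i).
  by rewrite mulr_ge0 //; have := t4; have := st; move: bs; lra.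
by move: (a i) => b; lra.
Qed.

End Truncation.
End Spectrum.

(** * Spectral decomposition of finite-rank operators *)

Section Selection.
Variables (R : realType) (p : nat).
Local Notation C := R[i].

Definition normsq (z : C) : R := complex.Re z ^+ 2 + complex.Im z ^+ 2.

Lemma normsq_ge0 z : 0 <= normsq z.
Proof. by rewrite addr_ge0 ?sqr_ge0. Qed.

Lemma normsqZ (t : R) z : normsq (t%:C%C * z) = t ^+ 2 * normsq z.
Proof. by case: z => x y; rewrite /normsq /=; ring. Qed.

Lemma normsqC z : normsq (Num.conj z) = normsq z.
Proof. by rewrite /normsq re_conj im_conj sqrrN. Qed.

Lemma Re_conj_mul (z : C) : complex.Re (Num.conj z * z) = normsq z.
Proof. by case: z => x y; rewrite /normsq /=; ring. Qed.

Definition diagR (a : 'I_p -> R) : 'M[C]_p := diag_mx (\row_i (a i)%:C%C).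

Lemma diagR_adj a : (diagR a)^t* = diagR a.
Proof.
apply/matrixP => i j; rewrite !mxE rmorphMn eq_sym.
case: eqP => [->|_]; last by rewrite !mulr0n.
by rewrite !mulr1n; exact: conjc_real.
Qed.

Lemma diagRM a b : diagR a *m diagR b = diagR (fun i => a i * b i).
Proof.
apply/matrixP => i j; rewrite mul_diag_mx !mxE mulrnAr -rmorphM.
by case: eqP => // ->.
Qed.

Lemma diagR1 : diagR (fun=> 1) = 1%:M.
Proof. by apply/matrixP => i j; rewrite !mxE. Qed.

Lemma sq_mul_diagR m (A : 'M[C]_(m, p)) a :
  sqnorm (A *m diagR a) = \sum_i \sum_j a j ^+ 2 * normsq (A i j).
Proof.
rewrite sqE; apply: eq_bigr => i _; apply: eq_bigr => j _.
by rewrite mul_mx_diag !mxE mulrC; exact: normsqZ.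
Qed.

Lemma sq_diagR_mul m (A : 'M[C]_(p, m)) a :
  sqnorm (diagR a *m A) = \sum_i \sum_j a i ^+ 2 * normsq (A i j).
Proof.
rewrite sqE; apply: eq_bigr => i _; apply: eq_bigr => j _.
by rewrite mul_diag_mx !mxE; exact: normsqZ.
Qed.

(** The eigenvalues of a Hermitian matrix are real, so that the ordered field of
    reals can be used for them. *)
Lemma hermitian_diagonalisation (M : 'M[C]_p) : M^t* = M ->
  exists2 P : 'M[C]_p, P \is unitarymx & exists b, P *m M *m P^t* = diagR b.
Proof.
move=> Mh; have Mn : M \is normalmx by apply/normalmxP; rewrite Mh.
exists (spectralmx M); first exact: spectral_unitarymx.
move: (spectralmx M) (spectral_unitarymx M) (orthomx_spectralP Mn) => P Pu.
move: (spectral_diag M) => sp; rewrite invmx_unitary // => ME.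
have PMP : P *m M *m P^t* = diag_mx sp.
  by rewrite ME !mulmxA unitary_ctr // mul1mx -mulmxA unitary_ctr // mulmx1.
have Dh : (diag_mx sp)^t* = diag_mx sp by rewrite -PMP !trmxCM trmxCK Mh mulmxA.
exists (fun k => complex.Re (sp 0 k)); rewrite PMP; congr diag_mx.
apply/rowP => k; rewrite mxE; have := congr1 (fun A : 'M[C]_p => A k k) Dh.
rewrite !mxE eqxx !mulr1n; case: (sp 0 k) => u v [] /=.
by move/eqP; rewrite eq_sym -addr_eq0 -mulr2n mulrn_eq0 /= => /eqP ->.
Qed.

Lemma sq_normsq m n (A : 'M[C]_(m, n)) : sqnorm A = \sum_i \sum_j normsq (A i j).
Proof. exact: sqE. Qed.

Definition selmx (P : pred 'I_p) : 'M[C]_(p, #|P|) :=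
  \matrix_(k, j) (k == enum_val j)%:R.

Lemma mulmx_sel m (A : 'M[C]_(m, p)) P i j :
  (A *m selmx P) i j = A i (enum_val j).
Proof.
rewrite mxE (bigD1 (enum_val j)) //= mxE eqxx mulr1 big1 ?addr0 // => k kj.
by rewrite mxE (negPf kj) mulr0.
Qed.

Lemma mul_sel_adj m (A : 'M[C]_(p, m)) P j i :
  ((selmx P)^t* *m A) j i = A (enum_val j) i.
Proof.
rewrite mxE (bigD1 (enum_val j)) //= !mxE eqxx rmorph1 mul1r big1 ?addr0 // => k kj.
by rewrite !mxE (negPf kj) rmorph0 mul0r.
Qed.

Lemma sel_isometry P : (selmx P)^t* *m selmx P = 1%:M.
Proof.
apply/matrixP => i j; rewrite mul_sel_adj !mxE.
by rewrite (inj_eq enum_val_inj).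
Qed.

Lemma mulmx_sel_sel m (A : 'M[C]_(m, p)) P : (forall i j, j \notin P -> A i j = 0) ->
  A *m selmx P *m (selmx P)^t* = A.
Proof.
move=> A0; apply/matrixP => i j; rewrite mxE.
under eq_bigr => k _ do rewrite mulmx_sel !mxE rmorph_nat.
rewrite -(big_enum_val (fun k => A i k * (j == k)%:R)) /=.
have [jP|jP] := boolP (j \in P).
  rewrite (bigD1 j) //= eqxx mulr1 big1 ?addr0 // => k /andP[_ kj].
  by rewrite eq_sym (negPf kj) mulr0.
rewrite A0 // big1 // => k kP; case: eqP => [jk|_]; last by rewrite mulr0.
by rewrite jk kP in jP.
Qed.

End Selection.

Section SpectralDecomposition.
Variables (R : realType) (T : Type) (m : (T -> R) -> R) (mP : mean m).
Local Notation C := R[i].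
Local Notation inn := (gram m).

Lemma inn_diag_ge0 n p (F : T -> 'M[C]_(n, p)) k : mbnd F ->
  0 <= complex.Re (inn F F k k).
Proof.
move=> Fb; rewrite mxE /=; apply: (mean_ge0 mP) => [|x].
  by have [] := mbndM (mbndC Fb) Fb k k.
rewrite mxE raddf_sum sumr_ge0 // => i _ /=.
by rewrite !mxE Re_conj_mul normsq_ge0.
Qed.

(** The finite-rank operator [B B^*] has a spectral decomposition [Y diag(a) Y^*];
    as the functions form only a pre-Hilbert space, it is read off the Gram matrix
    [inn B B], and equality holds up to null vectors. *)
Lemma spectral_decomposition n p (B : T -> 'M[C]_(n, p)) : mbnd B ->
  exists r (Y : T -> 'M[C]_(n, r)) (a : 'I_r -> R),
  [/\ mbnd Y, inn Y Y = 1%:M, forall i, 0 < a i, meansq m B = \sum_i a i &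
    forall q (F : T -> 'M[C]_(n, q)), mbnd F ->
      sqnorm (inn F B) = sqnorm (inn F Y *m diagR (fun i => Num.sqrt (a i)))].
Proof.
move=> Bb; have Mh : (inn B B)^t* = inn B B by rewrite innC.
have [P Pu [b PMP]] := hermitian_diagonalisation Mh.
pose F0 x := B x *m P^t*.
have F0b : mbnd F0 by exact: mbndMc.
have F0F0 : inn F0 F0 = diagR b.
  by rewrite (innMr mP _ F0b Bb) (innMl mP _ Bb Bb) trmxCK.
have b0 k : 0 <= b k.
  by have := inn_diag_ge0 k F0b; rewrite F0F0 !mxE eqxx mulr1n.
have hB : meansq m B = \sum_k b k.
  have -> : meansq m B = meansq m F0.
    by congr m; apply/funext => x; rewrite sq_isomr // trmxCK unitary_ctl.
  rewrite (hsq_inn mP F0b) F0F0 /dot trmxC1 mulmx1 mxtrace_diag raddf_sum.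
  by apply: eq_bigr => k _; rewrite mxE.
pose Q := [pred k | b k != 0].
pose S := selmx R Q.
pose a (j : 'I_#|Q|) := b (enum_val j).
have a0 (j : 'I_#|Q|) : 0 < a j.
  by rewrite lt_def b0 andbT; have := enum_valP j; rewrite inE.
pose D := diagR (fun j : 'I_#|Q| => (Num.sqrt (a j))^-1).
pose E := diagR (fun j : 'I_#|Q| => Num.sqrt (a j)).
have DE : D *m E = 1%:M.
  rewrite diagRM -diagR1; congr diagR; apply/funext => j.
  by rewrite mulVf // gt_eqF // sqrtr_gt0.
have SbS : S^t* *m diagR b *m S = E *m E.
  apply/matrixP => i j; rewrite mulmx_sel mul_sel_adj diagRM !mxE.
  by rewrite -expr2 sqr_sqrtr ?ltW // (inj_eq enum_val_inj).
have SS : S^t* *m S = 1%:M by exact: sel_isometry.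
exists #|Q|, (fun x => F0 x *m (S *m D)), a; split => //.
- exact: mbndMc.
- rewrite (innMr mP _ (mbndMc _ F0b) F0b) (innMl mP _ F0b F0b) F0F0.
  rewrite trmxCM diagR_adj -/D !mulmxA -(mulmxA D) -(mulmxA D) SbS mulmxA DE.
  rewrite mul1mx; have /mulmx1C := DE; by [].
- rewrite hB (bigID (mem Q)) /= addrC big1 ?add0r => [|k]; last first.
    by rewrite !inE negbK => /eqP.
  exact: big_enum_val.
move=> q F Fb.
(* The discarded eigenvectors of the Gram matrix give null vectors. *)
pose N x := F0 x *m (1%:M - S *m S^t*).
have Nb : mbnd N by exact: mbndMc.
have NN : inn N N = 0.
  rewrite (innMr mP _ Nb F0b) (innMl mP _ F0b F0b) F0F0 -mulmxA.
  rewrite mulmxBr mulmx1 mulmxA mulmx_sel_sel ?subrr ?mulmx0 // => i j.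
  rewrite !inE negbK => /eqP bj; rewrite !mxE.
  by case: eqP => [->|_]; rewrite ?mulr0n // bj.
have FN : inn F N = 0 by rewrite -(innC mP Nb Fb) (inn_null mP Nb Fb NN) trmxC0.
rewrite (innMr mP _ Fb F0b) -!mulmxA DE mulmx1.
have -> : inn F B = (inn F F0 *m S) *m (S^t* *m P).
  have -> : inn F B = inn F (fun x => F0 x *m P).
    congr (mxmean _ _); apply/funext => x.
    by rewrite /F0 -(mulmxA (B x)) unitary_ctl // mulmx1.
  rewrite (innMr mP _ Fb F0b) mulmxA; congr (_ *m P).
  move: FN; rewrite (innMr mP _ Fb F0b) mulmxBr mulmx1 mulmxA => /eqP.
  by rewrite subr_eq0 => /eqP.
rewrite sq_isomr; first by [].
by rewrite trmxCM trmxCK mulmxA -(mulmxA (S^t*)) (unitary_ctr Pu) mulmx1.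
Qed.

End SpectralDecomposition.

(** * Approximate dilation *)

Section ApproximateDilation.
Opaque sqnorm dot cmean meansq mxmean gram translate.
Variables (R : realType) (G : groupType) (m : (G -> R) -> R) (mP : mean m).
Hypothesis minv : forall (g : G) (f : G -> R), bnd f -> m (fun x => f (g * x)%g) = m f.
Local Notation C := R[i].
Local Notation inn := (gram m).
Local Notation hsq := (meansq m).

Lemma inn_translater n p q g (F : G -> 'M[C]_(n, p)) (F' : G -> 'M[C]_(n, q)) :
  mbnd F -> mbnd F' -> inn F (translate g F') = inn (translate g^-1%g F) F'.
Proof. by move=> Fb F'b; rewrite (inn_translatel minv g^-1%g Fb F'b) invgK. Qed.

Lemma inn_translate_isometry n p g (Y : G -> 'M[C]_(n, p)) : mbnd Y ->
  inn Y Y = 1%:M -> inn (translate g Y) (translate g Y) = 1%:M.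
Proof. by move=> Yb YY; rewrite (inn_translate minv g Yb Yb). Qed.

Lemma hsq_isometry n p (Y : G -> 'M[C]_(n, p)) : mbnd Y ->
  inn Y Y = 1%:M -> hsq Y = p%:R.
Proof. by move=> Yb YY; rewrite (hsq_inn mP Yb) YY dotxx sq1. Qed.

Lemma row_bessel n p q (Y : G -> 'M[C]_(n, p)) (Z : G -> 'M[C]_(n, q)) i :
  mbnd Y -> mbnd Z -> inn Y Y = 1%:M -> inn Z Z = 1%:M ->
  \sum_j normsq (inn Y Z i j) <= 1.
Proof.
move=> Yb Zb YY ZZ; pose d : 'M[C]_(p, 1) := delta_mx i 0.
have Ydb : mbnd (fun x => Y x *m d) by exact: mbndMc.
have dd : d^t* *m d = 1%:M.
  apply/matrixP => k l; rewrite !ord1 mxE (bigD1 i) //= !mxE !eqxx rmorph1 mulr1.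
  rewrite big1 ?addr0 // => j ji.
  by rewrite !mxE (negPf ji) /= mulr0.
have hd : hsq (fun x => Y x *m d) = 1.
  rewrite hsq_isometry // (innMr mP _ Ydb Yb) (innMl mP _ Yb Yb) YY.
  by rewrite mulmx1 dd.
have <- : sqnorm (inn Z (fun x => Y x *m d)) = \sum_j normsq (inn Y Z i j).
  rewrite (sq_innC mP Zb Ydb) (innMl mP _ Yb Zb) sq_normsq big_ord1.
  apply: eq_bigr => j _; congr normsq; rewrite mxE (bigD1 i) //= !mxE !eqxx.
  rewrite rmorph1 mul1r big1 ?addr0 // => k ki.
  by rewrite !mxE (negPf ki) /= rmorph0 mul0r.
by rewrite -hd; exact: bessel.
Qed.

Lemma col_bessel n p q (Y : G -> 'M[C]_(n, p)) (Z : G -> 'M[C]_(n, q)) j :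
  mbnd Y -> mbnd Z -> inn Y Y = 1%:M -> inn Z Z = 1%:M ->
  \sum_i normsq (inn Y Z i j) <= 1.
Proof.
move=> Yb Zb YY ZZ; apply: le_trans (row_bessel j Zb Yb ZZ YY).
apply: ler_sum => i _; rewrite -(innC mP Yb Zb) !mxE.
by rewrite normsqC.
Qed.

(** Compressing the translation action to the span of [Y] loses only the part of
    the [h]-translate of [Y] that leaves the span. *)
Lemma compression_defect n N (Y : G -> 'M[C]_(n, N)) g h : mbnd Y -> inn Y Y = 1%:M ->
  sqnorm (inn Y (translate g Y) *m inn Y (translate h Y) - inn Y (translate (g * h)%g Y)) <=
  N%:R - sqnorm (inn Y (translate h Y)).
Proof.
move=> Yb YY; have sb k := mbnd_translate k Yb.
have Eb := mbndB (sb h) (mbndMc (inn Y (translate h Y)) Yb).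
have <- : hsq (fun x => translate h Y x - Y x *m inn Y (translate h Y)) =
    N%:R - sqnorm (inn Y (translate h Y)).
  rewrite (hsq_proj mP Yb (sb h) YY).
  by rewrite (hsq_isometry (sb h) (inn_translate_isometry h Yb YY)).
have -> : inn Y (translate g Y) *m inn Y (translate h Y) - inn Y (translate (g * h)%g Y) =
    - inn (translate g^-1%g Y) (fun x => translate h Y x - Y x *m inn Y (translate h Y)).
  rewrite (innBr mP (sb _) (sb h) (mbndMc _ Yb)) (innMr mP _ (sb _) Yb).
  rewrite -(inn_translater g Yb (sb h)) -(inn_translater g Yb Yb) translateM opprB.
  by [].
by rewrite sqN; exact: (bessel mP (sb _) Eb (inn_translate_isometry _ Yb YY)).
Qed.

Section Orbit.
Variables (n : nat) (phi : G -> 'M[C]_n) (e : R).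
Hypothesis phiU : forall g, phi g \is unitarymx.
Hypothesis phie : forall g h, sqnorm (phi g *m phi h - phi (g * h)%g) <= e * n%:R.
Local Notation orb := (orb phi).

(** The map [v |-> (x |-> phi (x^-1) v)] almost intertwines [phi] with translation, and
    projecting to the span of [Y] spoils this little if the span almost contains its
    range. *)
Lemma compression_intertwines N (Y : G -> 'M[C]_(n, N)) d g : mbnd Y ->
  inn Y Y = 1%:M -> n%:R - d <= sqnorm (inn Y (orb 1%g)) ->
  sqnorm (inn Y (translate g Y) *m inn Y (orb 1%g) - inn Y (orb 1%g) *m phi g)
    <= 2 * (e * n%:R + d).
Proof.
move=> Yb YY Wd; have sb k := mbnd_translate k Yb; have ob := mbnd_orb phiU.
have V1b := ob 1%g.
pose W := inn Y (orb 1%g).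
have Eb := mbndB V1b (mbndMc W Yb).
have Fb := mbndB (ob g) (mbndMc (phi g) V1b).
have -> : inn Y (translate g Y) *m inn Y (orb 1%g) - inn Y (orb 1%g) *m phi g =
    inn Y (fun x => orb g x - orb 1%g x *m phi g) -
    inn (translate g^-1%g Y) (fun x => orb 1%g x - Y x *m W).
  rewrite (innBr mP (sb _) V1b (mbndMc _ Yb)) (innMr mP _ (sb _) Yb).
  rewrite -(inn_translater g Yb V1b) -(inn_translater g Yb Yb) translate_orb mulg1.
  rewrite (innBr mP Yb (ob g) (mbndMc _ V1b)) (innMr mP _ Yb V1b) opprB.
  by rewrite [RHS]addrC addrA subrK.
have b1 : sqnorm (inn Y (fun x => orb g x - orb 1%g x *m phi g)) <= e * n%:R.
  apply: le_trans (bessel mP Yb Fb YY) _.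
  by exact: (hsq_orb_defect mP phiU phie).
have b2 : sqnorm (inn (translate g^-1%g Y) (fun x => orb 1%g x - Y x *m W)) <= d.
  apply: le_trans (bessel mP (sb _) Eb (inn_translate_isometry _ Yb YY)) _.
  rewrite (hsq_proj mP Yb V1b YY) (hsq_orb mP phiU).
  by rewrite lerBlDl -lerBlDr.
apply: le_trans (sqB_le _ _) _.
by rewrite ler_pM2l // lerD.
Qed.


(** The spectral projection [Y Y^*] of a well-averaged, almost invariant operator
    [A], cut at a gap of its spectrum, is almost invariant itself; it has rank close
    to [n] and almost contains the span of [orb 1] because [A] is close to a
    projection: [n - tr A^2] is small. The number of eigenvalues above [1/4] is at
    most [4n], so the gap does not shrink with [eta]. *)
Lemma approximate_dilation eta : 0 < eta ->
  exists N (pi : G -> 'M[C]_N) (W : 'M[C]_(N, n)),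
  [/\ N%:R <= (1 + 4 * e) * n%:R, pi 1%g = 1%:M,
      forall g, pi g^-1%g = (pi g)^t* /\ sqnorm (pi g) <= N%:R,
      forall g h, sqnorm (pi g *m pi h - pi (g * h)%g) <= eta &
      [/\ n%:R - 5 * e * n%:R <= sqnorm W,
          forall q (u : 'M[C]_(N, q)), sqnorm (W^t* *m u) <= sqnorm u &
          forall g, sqnorm (pi g *m W - W *m phi g) <= 12 * e * n%:R]].
Proof.
move=> eta0.
have fin (x b1 b2 b3 b4 : R) : b3 <= 4 * e * x -> b1 <= b3 -> b2 <= b4 ->
    (1 - e) * x <= b2 + b1 -> x - 5 * e * x <= b4 by lra.
have lin1 (x : R) : 2 * (e * x + 5 * e * x) = 12 * e * x by lra.
pose kappa : R := 64 + 4 * (2 * (4 * n + 1)%:R) ^+ 2.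
have kappa0 : 0 < kappa by rewrite ltr_wpDr // mulr_ge0 // sqr_ge0.
(* The constant of [gap_estimate] for a gap of width [1 / (2 (4 n + 1))] is [kappa]. *)
have [p [B [[Bb BT BF Bo Bs] Binv]]] :=
  averaged_invariant mP minv phiU phie (divr_gt0 eta0 kappa0).
have [r [Y [a [Yb YY a0 suma sqB]]]] := spectral_decomposition mP Bb.
have sb k := mbnd_translate k Bb; have sY k := mbnd_translate k Yb.
have ob := mbnd_orb phiU.
pose D := diagR (fun i => Num.sqrt (a i)).
have YDb : mbnd (fun x => Y x *m D) by exact: mbndMc.
have sqrta i : Num.sqrt (a i) ^+ 2 = a i by rewrite sqr_sqrtr // ltW.
(* The overlap of [A] with its translate, written in the eigenbasis. *)
have sqB' h : sqnorm (inn B (translate h B)) =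
    \sum_i \sum_j a i * a j * normsq (inn Y (translate h Y) i j).
  rewrite (sq_innC mP Bb (sb h)) sqB // -(innMr mP D (sb h) Yb).
  rewrite (inn_translatel minv h Bb YDb) (sq_innC mP Bb (mbnd_translate _ YDb)).
  rewrite sqB; last exact: mbnd_translate.
  rewrite (inn_translatel minv _ YDb Yb) invgK (innMl mP D Yb (sY h)).
  rewrite diagR_adj -/D sq_mul_diagR; apply: eq_bigr => i _; apply: eq_bigr => j _.
  rewrite sqrta mul_diag_mx !mxE normsqZ sqrta mulrA (mulrC (a j)).
  by [].
have sumaa : sqnorm (inn B B) = \sum_i a i ^+ 2.
  rewrite -{2}[B]translate1 sqB' translate1 YY; apply: eq_bigr => i _.
  rewrite (bigD1 i) //= !mxE eqxx big1 ?addr0 => [|j ji]; last first.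
    by rewrite mxE eq_sym (negPf ji) /normsq /= expr0n /= addr0 mulr0.
  by rewrite /normsq /= expr1n expr0n /= addr0 mulr1.
have n_sum : \sum_i a i = n%:R by rewrite -suma BT.
have YX q (A : 'M[C]_(r, q)) :
    hsq (fun x => Y x *m A) = sqnorm A.
  have YAb := mbndMc A Yb.
  rewrite (hsq_inn mP YAb) (innMr mP _ YAb Yb) (innMl mP _ Yb Yb) YY mulmx1.
  by rewrite dot_mull trmxCK mulmx1 dotxx.
have a1 i : a i <= 1.
  pose d : 'M[C]_(r, 1) := delta_mx i 0.
  have Ydb : mbnd (fun x => Y x *m d) by exact: mbndMc.
  have normsq1 : normsq (1 : C) = 1 by rewrite /normsq /= expr1n expr0n addr0.
  have := BF _ _ Ydb; rewrite YX (sq_innC mP Bb Ydb) sqB //.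
  rewrite (innMl mP d Yb Yb) YY mulmx1 sq_mul_diagR big_ord1.
  rewrite (bigD1 i) //= !mxE !eqxx sqrta rmorph1 normsq1 mulr1.
  have -> : sqnorm d = 1.
    rewrite sq_normsq (bigD1 i) //= big_ord1 mxE !eqxx normsq1 big1 ?addr0 // => k ki.
    by rewrite big_ord1 mxE (negPf ki) /normsq /= expr0n addr0.
  apply: le_trans; rewrite lerDl sumr_ge0 // => j _.
  by rewrite mulr_ge0 ?sqr_ge0 ?normsq_ge0.
have sum2 : (1 - e) * n%:R <= \sum_i a i ^+ 2.
  by rewrite -sumaa; have := Bs 1%g; rewrite translate1.
have [s [t [s4 st t4 gapE gap]]] := eigenvalue_gap (fun i => ltW (a0 i)) n_sum.
have kappaE : 64 + 4 / (t - s) ^+ 2 = kappa.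
  have J0 : 2 * (4 * n + 1)%:R != 0 :> R.
    by rewrite mulf_eq0 !pnatr_eq0 addn1.
  have -> : t - s = (2 * (4 * n + 1)%:R)^-1.
    by apply: (mulfI J0); rewrite gapE mulfV.
  by rewrite exprVn invrK.
pose X h := inn Y (translate h Y).
have XX h : \sum_(i | t <= a i) 1 -
    \sum_(i | t <= a i) \sum_(j | t <= a j) normsq (X h i j) <= eta.
  have := @gap_estimate _ _ a (fun i j => normsq (X h i j)) s t (eta / kappa).
  rewrite kappaE [kappa * _]mulrC divfK ?gt_eqF //; apply => //.
  - by move=> i j; exact: normsq_ge0.
  - by move=> i; apply: (row_bessel i Yb (sY h) YY); exact: inn_translate_isometry.
  - by move=> j; apply: (col_bessel j Yb (sY h) YY); exact: inn_translate_isometry.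
  - by rewrite -sumaa -sqB'; exact: Binv.
(* The eigenvectors above the gap. *)
pose P := [pred i | t <= a i]; pose S := selmx R P; pose Z x := Y x *m S.
have Zb : mbnd Z by exact: mbndMc.
have ZZ : inn Z Z = 1%:M.
  by rewrite (innMr mP _ Zb Yb) (innMl mP _ Yb Yb) YY mulmx1 sel_isometry.
have sumP (f : 'I_r -> R) : \sum_(i < #|P|) f (enum_val i) = \sum_(i | t <= a i) f i.
  by rewrite -big_enum_val.
have NE : #|P|%:R = \sum_(i | t <= a i) 1 :> R.
  by rewrite -sumP sumr_const card_ord.
have sqZ h : sqnorm (inn Z (translate h Z)) =
    \sum_(i | t <= a i) \sum_(j | t <= a j) normsq (X h i j).
  rewrite translateMr (innMr mP S Zb (sY h)) (innMl mP S Yb (sY h)) -mulmxA sq_normsq.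
  rewrite -sumP; apply: eq_bigr => i _; rewrite -sumP; apply: eq_bigr => j _.
  by rewrite mul_sel_adj mulmx_sel.
pose v i := \sum_j normsq (inn Y (orb 1%g) i j).
have v1 i : v i <= 1 by apply: (row_bessel i Yb (ob _) YY); exact: inn_orb1.
have v0 i : 0 <= v i by apply: sumr_ge0 => j _; exact: normsq_ge0.
have sumav : (1 - e) * n%:R <= \sum_i a i * v i.
  have := Bo 1%g; rewrite sqB // -/D -sq_adj trmxCM diagR_adj (innC mP (ob _) Yb).
  rewrite sq_diagR_mul; under eq_bigr => i _ do rewrite -mulr_sumr sqrta.
  by [].
have sumv : n%:R - 5 * e * n%:R <= sqnorm (inn Z (orb 1%g)).
  have -> : sqnorm (inn Z (orb 1%g)) = \sum_(i | t <= a i) v i.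
    rewrite (innMl mP S Yb (ob _)) sq_normsq -sumP; apply: eq_bigr => i _.
    by apply: eq_bigr => j _; rewrite mul_sel_adj.
  have small := sum_small (fun i => ltW (a0 i)) a1 n_sum sum2 st t4 gap.
  have h1 : \sum_(i | ~~ (t <= a i)) a i * v i <= \sum_(i | ~~ (t <= a i)) a i.
    by apply: ler_sum => i _; rewrite ler_piMr // ltW.
  have h2 : \sum_(i | t <= a i) a i * v i <= \sum_(i | t <= a i) v i.
    by apply: ler_sum => i _; rewrite ler_piMl.
  move: sumav; rewrite (bigID (fun i => t <= a i)) /= => h3.
  exact: fin small h1 h2 h3.
exists #|P|, (fun g => inn Z (translate g Z)), (inn Z (orb 1%g)); split.
- by rewrite NE; exact: (count_large (fun i => ltW (a0 i)) a1 n_sum sum2 s4 st).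
- by rewrite translate1.
- move=> g; have sZ := mbnd_translate g Zb; split.
    by rewrite -(inn_translatel minv g Zb Zb) (innC mP Zb sZ).
  apply: le_trans (bessel mP Zb sZ ZZ) _.
  by rewrite (hsq_isometry sZ (inn_translate_isometry g Zb ZZ)).
- move=> g h; apply: le_trans (compression_defect g h Zb ZZ) _.
  by rewrite NE sqZ.
split => // [q u|g].
  rewrite (innC mP Zb (ob _)) -(innMr mP u (ob _) Zb).
  have Zub : mbnd (fun x => Z x *m u) by exact: mbndMc.
  apply: le_trans (bessel mP (ob _) Zub (inn_orb1 mP phiU)) _.
  rewrite (_ : (fun x => Z x *m u) = (fun x => Y x *m (S *m u))); last first.
    by apply/funext => x; rewrite mulmxA.
  by rewrite YX sq_isom //; exact: sel_isometry.
rewrite -lin1; exact: compression_intertwines.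
Qed.

End Orbit.
End ApproximateDilation.

(** * Exact dilation by an ultralimit *)

Section Ultralimit.
Import numFieldNormedType.Exports.
Local Open Scope classical_set_scope.
Local Open Scope ring_scope.
Variable R : realType.

(** A limit along an ultrafilter: a mean that is multiplicative as well, so that it
    carries polynomial identities between matrix entries over to the limit. *)
Lemma ultralimit : exists L : (nat -> R) -> R, [/\ mean L,
  forall f g, bnd f -> bnd g -> L (fun k => f k * g k) = L f * L g &
  forall f, bnd f -> (forall k, f k <= k.+1%:R^-1) -> L f <= 0].
Proof.
have [U [UU leU]] := ultraFilterLemma (@eventually_filter).
have FU : ProperFilter U by exact: ultra_proper.
have cvgU (u : nat -> R) : bnd u -> cvg (u @ U).
  move=> [K uK].
  have inK : (u @ U) `[- K, K]%classic.
    apply: (@filterS _ U _ setT); last exact: filterT.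
    by move=> k _ /=; rewrite in_itv /= -ler_norml.
  have [l [_ lcl]] := @segment_compact R (- K) K (u @ U) _ inK.
  apply: (cvgP l) => A lA; have [//|nA] := in_ultra_setVsetC (u @^-1` A) UU.
  have [x [xA]] := lcl (~` A)%classic A nA lA.
  by [].
exists (fun u => lim (u @ U)); split.
- split.
  + move=> a f g fb gb; apply: cvg_lim => //; apply: cvgD; last exact: cvgU.
    by apply: cvgMl_tmp; exact: cvgU.
  + move=> f fb f0; apply: limr_ge; first exact: cvgU.
    by apply: nearW.
  + exact: lim_cst.
- by move=> f g fb gb; apply: limM; exact: cvgU.
- move=> f fb f1; apply/ler_addgt0Pr => e e0; rewrite add0r.
  apply: limr_le; first exact: cvgU.
  apply: leU; have := near_infty_natSinv_lt (PosNum e0).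
  by apply: filterS => k /= ke; exact: le_trans (f1 k) (ltW ke).
Qed.

End Ultralimit.

Section MultiplicativeMean.
Variable R : realType.
Local Notation C := R[i].
Variables (L : (nat -> R) -> R) (LP : mean L).
Hypothesis LM : forall f g, bnd f -> bnd g -> L (fun k => f k * g k) = L f * L g.

Lemma cmeanM (f g : nat -> C) : cbnd f -> cbnd g ->
  cmean L (fun k => f k * g k) = cmean L f * cmean L g.
Proof.
move=> [f1 f2] [g1 g2]; apply/eqP; rewrite eq_complex re_mul im_mul /=.
rewrite -!LM // -(meanN LP) -?(meanD LP); try by repeat first
  [apply: bndM|apply: bndN].
by apply/andP; split; apply/eqP; congr L; apply/funext => x; rewrite ?re_mul ?im_mul.
Qed.

Lemma mxmeanM p q r (A : nat -> 'M[C]_(p, q)) (B : nat -> 'M[C]_(q, r)) :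
  mbnd A -> mbnd B -> mxmean L (fun k => A k *m B k) = mxmean L A *m mxmean L B.
Proof.
move=> Ab Bb; apply/matrixP => i j; rewrite !mxE.
under eq_fun do rewrite mxE.
rewrite (cmean_sum LP) => [|k]; last exact: cbndM.
by apply: eq_bigr => k _; rewrite !mxE cmeanM.
Qed.

Lemma mxmeanB p q (A B : nat -> 'M[C]_(p, q)) : mbnd A -> mbnd B ->
  mxmean L (fun k => A k - B k) = mxmean L A - mxmean L B.
Proof.
move=> Ab Bb; have := mxmeanD LP (mbndB Ab Bb) Bb.
have -> : (fun k => A k - B k + B k) = A by apply/funext => k; rewrite subrK.
by move=> ->; rewrite addrK.
Qed.

Lemma sq_mxmean p q (A : nat -> 'M[C]_(p, q)) : mbnd A ->
  sqnorm (mxmean L A) = L (fun k => sqnorm (A k)).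
Proof.
move=> Ab; have Cb := mbndC Ab.
rewrite /sqnorm /dot -(mxmeanC LP) // -mxmeanM //.
rewrite /mxtrace; under eq_bigr do rewrite mxE.
rewrite -(cmean_sum LP) //.
by move=> i; exact: mbndM.
Qed.

End MultiplicativeMean.

Section ExactDilation.
Variables (R : realType) (G : groupType) (m : (G -> R) -> R) (mP : mean m).
Hypothesis minv : forall (g : G) (f : G -> R), bnd f -> m (fun x => f (g * x)%g) = m f.
Local Notation C := R[i].
Variables (n : nat) (phi : G -> 'M[C]_n) (e : R).
Hypothesis phiU : forall g, phi g \is unitarymx.
Hypothesis phie : forall g h, sqnorm (phi g *m phi h - phi (g * h)%g) <= e * n%:R.

Lemma common_lower_bound (f : nat -> R) K : (forall N, 0 < f N) ->
  exists2 eta, 0 < eta & forall N, (N < K)%N -> eta <= f N.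
Proof.
move=> f0; elim: K => [|K [eta eta0 IH]]; first by exists 1.
exists (Num.min eta (f K)); first by rewrite lt_min eta0 f0.
move=> N; rewrite ltnS leq_eqVlt => /orP[/eqP ->|NK].
  by rewrite ge_min lexx orbT.
by rewrite ge_min IH.
Qed.

Let dilation eta N (pi : G -> 'M[C]_N) (W : 'M[C]_(N, n)) :=
  [/\ pi 1%g = 1%:M,
      forall g, pi g^-1%g = (pi g)^t* /\ sqnorm (pi g) <= N%:R,
      forall g h, sqnorm (pi g *m pi h - pi (g * h)%g) <= eta &
      [/\ n%:R - 5 * e * n%:R <= sqnorm W,
          forall q (u : 'M[C]_(N, q)), sqnorm (W^t* *m u) <= sqnorm u &
          forall g, sqnorm (pi g *m W - W *m phi g) <= 12 * e * n%:R]].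

(** The ranks of the approximate dilations are bounded, so one of them serves for
    arbitrarily small errors. *)
Lemma dilation_of_constant_rank :
  exists2 N, N%:R <= (1 + 4 * e) * n%:R & 
    forall eta, 0 < eta -> exists x : (G -> 'M[C]_N) * 'M[C]_(N, n), dilation eta x.1 x.2.
Proof.
apply: contrapT => noN.
pose ok N eta := exists x : (G -> 'M[C]_N) * 'M[C]_(N, n), dilation eta x.1 x.2.
have pick N : exists eta, 0 < eta /\ (N%:R <= (1 + 4 * e) * n%:R -> ~ ok N eta).
  have [NK|NK] := pselect (N%:R <= (1 + 4 * e) * n%:R); last by exists 1.
  apply: contrapT => noeta; apply: noN; exists N => // eta eta0.
  by apply: contrapT => noti; apply: noeta; exists eta.
have [f fP] := choice pick.
have [K Kn] : exists K : nat, (1 + 4 * e) * n%:R < K%:R.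
  exists (Num.bound `|(1 + 4 * e) * n%:R|).
  exact: le_lt_trans (ler_norm _) (archi_boundP (normr_ge0 _)).
have [eta eta0 etaf] := common_lower_bound K (fun N => (fP N).1).
have [N [pi [W [NK p1 pV pM pW]]]] := approximate_dilation mP minv phiU phie eta0.
have [_ /(_ NK) []] := fP N.
exists (pi, W); split => // g h; apply: le_trans (pM g h) _.
by apply: etaf; rewrite -(ltr_nat R); exact: le_lt_trans NK Kn.
Qed.

(** For a fixed rank the approximate dilations range over a compact set, and the
    conditions on them are closed, so a limit as the error tends to zero is exact. *)
Lemma exact_dilation :
  exists N (pi : G -> 'M[C]_N) (W : 'M[C]_(N, n)),
  [/\ N%:R <= (1 + 4 * e) * n%:R, unitary_rep pi,
      n%:R - 5 * e * n%:R <= sqnorm W,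
      forall q (u : 'M[C]_(N, q)), sqnorm (W^t* *m u) <= sqnorm u &
      forall g, sqnorm (pi g *m W - W *m phi g) <= 12 * e * n%:R].
Proof.
have [L [LP LM L0]] := ultralimit R.
have [N NK dil] := dilation_of_constant_rank.
have inv0 (k : nat) : 0 < k.+1%:R^-1 :> R by rewrite invr_gt0 ltr0Sn.
have [x xP] := choice (fun k : nat => dil k.+1%:R^-1 (inv0 k)).
pose pi k := (x k).1; pose W k := (x k).2.
have pb g : mbnd (fun k => pi k g).
  by apply: (@sq_mbnd _ _ _ _ N%:R) => k; have [_ /(_ g) []] := xP k.
have Wb : mbnd W.
  apply: (@sq_mbnd _ _ _ _ N%:R) => k; have [_ _ _ [_ /(_ _ 1%:M)]] := xP k.
  by rewrite mulmx1 sq_adj sq1.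
pose piL g := mxmean L (fun k => pi k g); pose WL := mxmean L W.
have piL1 : piL 1%g = 1%:M.
  rewrite -[RHS](mxmean_cst LP); congr (mxmean _ _); apply/funext => k.
  by have [] := xP k.
have piLV g : piL g^-1%g = (piL g)^t*.
  rewrite -(mxmeanC LP) //; congr (mxmean _ _); apply/funext => k.
  by have [_ /(_ g) []] := xP k.
have piLM g h : piL (g * h)%g = piL g *m piL h.
  apply/eqP; rewrite eq_sym -subr_eq0; apply/eqP/sq_eq0/eqP.
  rewrite eq_le sq_ge0 andbT -(mxmeanM LP LM) // -(mxmeanB LP) //; last exact: mbndM.
  have Db : mbnd (fun k => pi k g *m pi k h - pi k (g * h)%g).
    by apply: mbndB => //; exact: mbndM.
  rewrite (sq_mxmean LP LM Db); apply: L0; first exact: mbnd_sq.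
  by move=> k; have [_ _ + _] := xP k; exact.
exists N, piL, WL; split => //.
- split => // g; apply/unitarymxP.
  by rewrite -piLV -piLM mulgV piL1.
- rewrite (sq_mxmean LP LM Wb) -[leLHS](mean_cst LP).
  apply: (mean_le LP) => [||k]; [exact: bnd_cst|exact: mbnd_sq|].
  by have [_ _ _ []] := xP k.
- move=> q u; have Wub : mbnd (fun k => (W k)^t* *m u) by apply/mbndMc/mbndC.
  rewrite -(mxmeanC LP) // -(mxmean_mulr LP) //; last exact: mbndC.
  rewrite (sq_mxmean LP LM Wub) -[leRHS](mean_cst LP).
  apply: (mean_le LP) => [||k]; [exact: mbnd_sq|exact: bnd_cst|].
  by have [_ _ _ [_ + _]] := xP k; exact.
- move=> g; have Wgb : mbnd (fun k => pi k g *m W k - W k *m phi g).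
    by apply: mbndB; [exact: mbndM|exact: mbndMc].
  have -> : piL g *m WL - WL *m phi g =
      mxmean L (fun k => pi k g *m W k - W k *m phi g).
    rewrite -(mxmeanM LP LM) // -(mxmean_mulr LP) // -(mxmeanB LP) //.
      exact: mbndM.
    exact: mbndMc.
  rewrite (sq_mxmean LP LM Wgb) -[leRHS](mean_cst LP).
  apply: (mean_le LP) => [||k]; [exact: mbnd_sq|exact: bnd_cst|].
  by have [_ _ _ [_ _]] := xP k; exact.
Qed.

End ExactDilation.

(** * Polar decomposition *)

Section Polar.
Variable R : realType.
Local Notation C := R[i].

Lemma row_mul_adj n (A : 'M[C]_n) i j : (A *m A^t*) i j = (row i A *m (row j A)^t*) 0 0.
Proof. by rewrite !mxE; apply: eq_bigr => k _; rewrite !mxE. Qed.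

(** Gram-Schmidt extension, with the given orthonormal rows at prescribed positions:
    as long as a row is missing, the others do not span, and a unit vector
    orthogonal to them can be put there. *)
Lemma unitary_completion n (Y : 'M[C]_n) (A : {set 'I_n}) :
  {in A &, forall i j, (Y *m Y^t*) i j = (i == j)%:R} ->
  exists2 V : 'M[C]_n, V \is unitarymx & {in A, forall i, row i V = row i Y}.
Proof.
move: {2}(#|~: A|) (leqnn #|~: A|) => k.
elim: k A Y => [|k IH] A Y.
  rewrite leqn0 cards_eq0 => /eqP A0 YY.
  have inA i : i \in A.
    by have : i \notin ~: A; [rewrite A0 inE|rewrite inE negbK].
  by exists Y => //; apply/unitarymxP/matrixP => i j; rewrite YY // mxE.
move=> Ak YY.
have [A0|[i0 i0A]] := set_0Vmem (~: A).
  by apply: IH => //; rewrite A0 cards0.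
pose Z := \matrix_i (if i \in A then row i Y else 0).
have : \det (Z^t*) == 0.
  rewrite (expand_det_col _ i0) big1 // => i _.
  by move: i0A; rewrite inE !mxE => /negPf ->; rewrite mxE rmorph0 mul0r.
case/det0P => v v0 vZ.
have sv0 : 0 < sqnorm v.
  rewrite lt_def sq_ge0 andbT; apply: contra v0 => /eqP /sq_eq0 ->.
  by [].
pose w := ((Num.sqrt (sqnorm v))^-1)%:C%C *: v.
have sw : sqnorm w = 1 by rewrite sqZ exprVn sqr_sqrtr ?mulVf ?gt_eqF ?ltW.
have wv (u : 'rV[C]_n) : v *m u^t* = 0 -> w *m u^t* = 0.
  by move=> vu; rewrite -scalemxAl vu scaler0.
have wY i : i \in A -> w *m (row i Y)^t* = 0.
  move=> iA; apply: wv; apply/matrixP => a b; rewrite !ord1 [RHS]mxE.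
  have <- : (v *m Z^t*) 0 i = 0 by rewrite vZ mxE.
  rewrite [LHS]mxE [RHS]mxE; apply: eq_bigr => l _.
  by rewrite !mxE iA mxE.
have ww : w *m w^t* = 1%:M.
  have hw : (w *m w^t*)^t* = w *m w^t* by rewrite trmxCM trmxCK.
  apply/matrixP => a b; rewrite !ord1 [RHS]mxE eqxx.
  have := congr1 (fun M : 'M[C]_1 => M 0 0) hw; rewrite mxE [_^T%R _ _]mxE.
  move: sw; rewrite /sqnorm /dot /mxtrace big_ord1.
  case: ((w *m w^t*) 0 0) => x y /= -> [] /eqP.
  by rewrite eq_sym -addr_eq0 -mulr2n mulrn_eq0 /= => /eqP ->.
pose Y' := \matrix_i (if i == i0 then w else row i Y).
have [||V Vu VY] := IH (i0 |: A) Y'.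
- rewrite finset.setCU -ltnS; apply: leq_trans Ak.
  apply: proper_card; apply/properP; split; first exact: finset.subsetIr.
  by exists i0 => //; rewrite !inE eqxx.
- move=> i j; rewrite !inE row_mul_adj !rowK.
  move: i0A; rewrite inE => i0A.
  have [->|ii0] := eqVneq i i0; have [->|ji0] := eqVneq j i0 => /=.
  + by move=> _ _; rewrite ww mxE !eqxx.
  + by move=> _ jA; rewrite wY // mxE.
  + move=> iA _; have -> : row i Y *m w^t* = 0; last by rewrite mxE (negPf ii0).
    by rewrite -[LHS]trmxCK trmxCM trmxCK wY // trmxC0.
  + by move=> iA jA; rewrite -row_mul_adj YY.
exists V => // i iA; rewrite VY ?inE ?iA ?orbT // rowK.
by case: eqP => // ii0; move: i0A; rewrite inE -ii0 iA.
Qed.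

(** Polar decomposition puts a contraction near a unitary matrix: its singular values [s]
    lie in [0, 1], where [(1 - s)^2 <= 1 - s^2]. *)
Lemma polar_approx n (X : 'M[C]_n) :
  (forall q (u : 'M[C]_(n, q)), sqnorm (X^t* *m u) <= sqnorm u) ->
  exists2 U : 'M[C]_n, U \is unitarymx & sqnorm (U - X) <= n%:R - sqnorm X.
Proof.
move=> Xc.
have Mh : (X *m X^t*)^t* = X *m X^t* by rewrite trmxCM trmxCK.
have [P Pu [c PMP]] := hermitian_diagonalisation Mh.
pose Y := P *m X.
have YYc : Y *m Y^t* = diagR c by rewrite trmxCM !mulmxA -(mulmxA P).
pose b i := sqnorm (row i Y).
have YYb : Y *m Y^t* = diagR b.
  rewrite YYc; congr diag_mx; apply/rowP => i; rewrite !mxE /b /sqnorm /dot.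
  by rewrite /mxtrace big_ord1 -row_mul_adj YYc !mxE eqxx mulr1n.
have b0 i : 0 <= b i by exact: sq_ge0.
have b1 i : b i <= 1.
  rewrite /b /Y rowE mulmxA -sq_adj trmxCM; apply: le_trans (Xc _ _) _.
  rewrite sq_adj sq_isomr ?unitary_ctr // sqE big_ord1 (bigD1 i) //= !mxE !eqxx.
  rewrite expr1n expr0n /= addr0 big1 ?addr0 // => j ji.
  by rewrite mxE (negPf ji) andbF /= expr0n addr0.
pose s i := Num.sqrt (b i).
have s0 i : 0 <= s i by exact: sqrtr_ge0.
have ss i : s i ^+ 2 = b i by rewrite sqr_sqrtr.
pose A := [set i | b i != 0].
pose Y0 := diagR (fun i => (s i)^-1) *m Y.
have [|V Vu VY] := @unitary_completion _ Y0 A.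
  move=> i j; rewrite !inE => bi bj.
  rewrite trmxCM diagR_adj mulmxA -(mulmxA _ Y) YYb !diagRM !mxE.
  case: eqP => // _; rewrite mulr1n -ss expr2 mulrA mulVf ?mul1r ?mulfV //.
    by rewrite /s sqrtr_eq0 -ltNge lt_def bi b0.
  by rewrite /s sqrtr_eq0 -ltNge lt_def bi b0.
have YV : Y = diagR s *m V.
  apply/matrixP => i j; rewrite mul_diag_mx [RHS]mxE [X in _ = X * _]mxE.
  have [bi|bi] := eqVneq (b i) 0.
    rewrite /s bi sqrtr0 mul0r.
    by have := congr1 (fun M : 'rV[C]_n => M 0 j) (sq_eq0 bi); rewrite !mxE.
  have -> : V i j = ((s i)^-1)%:C%C * Y i j.
    have := VY i; rewrite inE => /(_ bi)/(congr1 (fun M : 'rV[C]_n => M 0 j)).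
    have -> : row i V 0 j = V i j by rewrite mxE.
    have -> : row i Y0 0 j = Y0 i j by rewrite mxE.
    by move=> ->; rewrite /Y0 mul_diag_mx [LHS]mxE [X in X * _ = _]mxE.
  rewrite mulrA -rmorphM mulfV ?mul1r //.
  by rewrite /s sqrtr_eq0 -ltNge lt_def bi b0.
have PVu : P^t* \is unitarymx by rewrite (trmxC_unitary P).
(* [X = P^* diag(s) V] is a singular value decomposition. *)
exists (P^t* *m V); first exact: mul_unitarymx PVu Vu.
have -> : P^t* *m V - X = P^t* *m (V - Y).
  by rewrite mulmxBr /Y mulmxA unitary_ctl // mul1mx.
rewrite sq_isom ?trmxCK ?unitary_ctr //.
have -> : V - Y = (1%:M - diagR s) *m V by rewrite mulmxBl mul1mx -YV.
have -> : sqnorm X = sqnorm Y by rewrite sq_isom // unitary_ctl.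
rewrite YV !sq_isomr ?unitary_ctr //.
have -> : 1%:M - diagR s = diagR (fun i => 1 - s i).
  apply/matrixP => i j; rewrite !mxE; case: eqP => _; last by rewrite !mulr0n subr0.
  by rewrite !mulr1n rmorphB.
have sqd (a : 'I_n -> R) : sqnorm (diagR a) = \sum_i a i ^+ 2.
  rewrite -[diagR a]mul1mx sq_mul_diagR; apply: eq_bigr => i _.
  rewrite (bigD1 i) //= !mxE eqxx big1 ?addr0 => [|j ji].
    by rewrite /normsq /= expr1n expr0n addr0 mulr1.
  by rewrite mxE eq_sym (negPf ji) /normsq /= expr0n addr0 mulr0.
have -> : n%:R = \sum_(i < n) (1 : R) by rewrite sumr_const card_ord.
rewrite !sqd -sumrB; apply: ler_sum => i _.
have s1 : s i <= 1 by rewrite -(@ler_pXn2r _ 2) ?nnegrE // ss expr1n.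
have := mulr_ge0 (s0 i) (_ : 0 <= 1 - s i); rewrite subr_ge0 => /(_ s1).
by move: (s i) => x; lra.
Qed.

End Polar.

(** * Invariant subspaces of prescribed dimension *)

Section Subrepresentations.
Variables (R : realType) (G : groupType).
Local Notation C := R[i].

Lemma unitary_repV N (pi : G -> 'M[C]_N) g : unitary_rep pi ->
  pi g^-1%g = (pi g)^t*.
Proof.
move=> [piU piM]; have pi1 : pi 1%g = 1%:M.
  have := piM 1%g 1%g; rewrite mulg1 => /(congr1 (mulmx ((pi 1%g)^t*))).
  by rewrite mulmxA unitary_ctl // mul1mx.
have := piM g^-1%g g; rewrite mulVg pi1 => /(congr1 (mulmx^~ ((pi g)^t*))).
by rewrite mul1mx -mulmxA unitary_ctr // mulmx1 => ->.
Qed.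

(** The columns of [S] form an orthonormal basis of an invariant subspace. *)
Definition intertwines N p (pi : G -> 'M[C]_N) (S : 'M[C]_(N, p)) :=
  S^t* *m S = 1%:M /\ forall g, exists D, pi g *m S = S *m D.

Lemma intertwinesE N p (pi : G -> 'M[C]_N) (S : 'M[C]_(N, p)) g :
  intertwines pi S -> pi g *m S = S *m (S^t* *m pi g *m S).
Proof.
move=> [SS /(_ g) [D SD]].
by rewrite -mulmxA SD (mulmxA (S^t*)) SS mul1mx.
Qed.

Lemma subrepresentation N p (pi : G -> 'M[C]_N) (S : 'M[C]_(N, p)) :
  unitary_rep pi -> intertwines pi S -> unitary_rep (fun g => S^t* *m pi g *m S).
Proof.
move=> [piU piM] SI; have [SS _] := SI; split=> [g|g h].
  apply/unitarymxP; apply: mulmx1C.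
  rewrite !trmxCM trmxCK -!mulmxA (mulmxA (S^t*) (pi g)) -(intertwinesE g SI).
  by rewrite (mulmxA ((pi g)^t*)) unitary_ctl // mul1mx.
rewrite piM -!mulmxA; congr (_ *m _); congr (_ *m _).
by rewrite (mulmxA (S^t*)) -intertwinesE.
Qed.

(** An invariant subspace of a unitary representation reduces it: the projection onto the
    subspace commutes with the representation as well. *)
Lemma adj_intertwinesE N p (pi : G -> 'M[C]_N) (S : 'M[C]_(N, p)) g :
  unitary_rep pi -> intertwines pi S ->
  S^t* *m pi g = (S^t* *m pi g *m S) *m S^t*.
Proof.
move=> piR SI; have := intertwinesE g^-1%g SI.
move/(congr1 (fun A => A^t*)).
by rewrite !trmxCM (unitary_repV g piR) !trmxCK !mulmxA.
Qed.

Lemma intertwines_comp N p q (pi : G -> 'M[C]_N) (S : 'M[C]_(N, p)) (S' : 'M[C]_(p, q)) :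
  intertwines pi S -> intertwines (fun g => S^t* *m pi g *m S) S' ->
  intertwines pi (S *m S').
Proof.
move=> SI [SS' SD']; have [SS _] := SI; split.
  by rewrite trmxCM mulmxA -(mulmxA (S'^t*)) SS mulmx1.
move=> g; have [D SD] := SD' g; exists D.
by rewrite mulmxA (intertwinesE g SI) -mulmxA SD !mulmxA.
Qed.

Lemma intertwines_row_mx N p q (pi : G -> 'M[C]_N) (S : 'M[C]_(N, p)) (S' : 'M[C]_(N, q)) :
  S^t* *m S' = 0 -> intertwines pi S -> intertwines pi S' ->
  intertwines pi (row_mx S S').
Proof.
move=> SS'0 [SS SD] [SS' SD']; split.
  have S'S0 : S'^t* *m S = 0 by rewrite -[LHS]trmxCK trmxCM trmxCK SS'0 trmxC0.
  by rewrite tr_row_mx map_col_mx mul_col_row SS SS'0 S'S0 SS' -scalar_mx_block.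
move=> g; have [D Dg] := SD g; have [D' Dg'] := SD' g.
exists (block_mx D 0 0 D').
by rewrite mul_mx_row mul_row_block !mulmx0 addr0 add0r Dg Dg'.
Qed.

Lemma isometry_resolution N a b (S : 'M[C]_(N, a)) (S' : 'M[C]_(N, b)) :
  (a + b = N)%N -> S^t* *m S = 1%:M -> S'^t* *m S' = 1%:M -> S^t* *m S' = 0 ->
  S *m S^t* + S' *m S'^t* = 1%:M.
Proof.
move=> abN SS SS' SS'0; subst N.
have S'S0 : S'^t* *m S = 0 by rewrite -[LHS]trmxCK trmxCM trmxCK SS'0 trmxC0.
have := mul_col_row (S^t*) (S'^t*) S S'.
rewrite SS SS' SS'0 S'S0 -scalar_mx_block => /mulmx1C.
by rewrite mul_row_col.
Qed.

(** An invariant subspace and its orthogonal complement, in terms of orthonormal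
    bases. Row spaces of matrices hold the adjoints of the vectors of [V]. *)
Lemma invariant_split N (pi : G -> 'M[C]_N) (V : {vspace 'cV[C]_N}) :
  unitary_rep pi -> invariant_subspace pi V -> V <> 0%VS -> V <> fullv ->
  exists a b (S : 'M[C]_(N, a)) (S' : 'M[C]_(N, b)),
  [/\ (0 < a)%N, (0 < b)%N, (a + b = N)%N, S^t* *m S' = 0 &
      intertwines pi S /\ intertwines pi S'].
Proof.
move=> piR Vinv V0 VT; have [piU piM] := piR.
pose A := \matrix_(i < \dim V) ((vbasis V)`_i)^t*.
have inV (v : 'cV[C]_N) : v \in V -> (v^t* <= A)%MS.
  move=> vV; rewrite (coord_vbasis vV).
  have -> : (\sum_i coord (vbasis V) i v *: (vbasis V)`_i)^t* =
      (\row_i Num.conj (coord (vbasis V) i v)) *m A.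
    rewrite mulmx_sum_row raddf_sum /= map_mx_sum; apply: eq_bigr => i _.
    by rewrite rowK mxE linearZ /= map_mxZ.
  exact: submxMl.
have Vin (w : 'rV[C]_N) : (w <= A)%MS -> w^t* \in V.
  move=> /submxP [D ->]; rewrite mulmx_sum_row raddf_sum /= map_mx_sum memv_suml //.
  move=> i _; rewrite rowK linearZ /= map_mxZ -/(trmx _) trmxCK memvZ //.
  by rewrite vbasis_mem // mem_nth // size_tuple.
have abN := add_rank_ortho A.
have := unitarymxP (schmidt_complete_unitarymx A).
rewrite /schmidt_complete.
have BA : (schmidt (row_base A) :=: A)%MS.
  by apply: eqmx_trans (eqmx_schmidt_free _) (eq_row_base A); exact: row_base_free.
move: (schmidt (row_base A)) BA => B BA.
move: (schmidt _) => B'; move: (\rank (orthomx _ _ _)) abN B' => b abN B'.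
rewrite tr_col_mx map_row_mx mul_col_row scalar_mx_block => /eq_block_mx[BB BB' B'B B'B'].
have SI : intertwines pi (B^t*).
  split; first by rewrite trmxCK.
  move=> g; have : ((pi g *m B^t*)^t* <= B)%MS.
    apply/row_subP => i; rewrite BA.
    have -> : row i ((pi g *m B^t*)^t*) = (pi g *m (row i B)^t*)^t*.
      by rewrite !trmxCM !trmxCK row_mul.
    apply/inV/Vinv/Vin; apply: submx_trans (row_sub i B) _.
    by rewrite BA submx_refl.
  case/submxP => D /(congr1 (fun X => X^t*)); rewrite trmxCK trmxCM => ->.
  by exists (D^t*).
exists (\rank A), b, (B^t*), (B'^t*); split => //.
- rewrite lt0n; apply/eqP => A0; apply: V0.
  apply/eqP; rewrite -subv0; apply/subvP => v /inV /mxrankS.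
  rewrite A0 leqn0 mxrank_eq0 => /eqP v0.
  by rewrite -[v]trmxCK v0 trmxC0 mem0v.
- rewrite lt0n; apply/eqP => b0; apply: VT.
  apply/eqP; rewrite eqEsubv subvf /=; apply/subvP => v _.
  rewrite -[v]trmxCK; apply: Vin; rewrite submx_full // /row_full.
  by rewrite -[X in _ == X]abN b0 addn0.
- by rewrite trmxCK.
split => //; split; first by rewrite trmxCK.
move=> g; exists (B' *m pi g *m B'^t*).
have res := isometry_resolution abN (S := B^t*) (S' := B'^t*).
rewrite !trmxCK in res; have {}res := res BB B'B' BB'.
rewrite -[pi g *m _]mul1mx -res mulmxDl -!mulmxA.
have -> : B *m (pi g *m B'^t*) = 0; last by rewrite mulmx0 add0r.
have := adj_intertwinesE g piR SI; rewrite trmxCK mulmxA => ->.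
by rewrite -!mulmxA BB' !mulmx0.
Qed.

(** Add irreducible summands, each of dimension at most [d], until the next one would
    overshoot [n]. Formally: split a reducible representation, and recurse into
    whichever summand the target dimension falls in. *)
Lemma invariant_subspace_of_dim d : irreps_dim_le R G d ->
  forall N n (pi : G -> 'M[C]_N), unitary_rep pi -> (n <= N)%N ->
  exists p (S : 'M[C]_(N, p)), [/\ (p <= n)%N, (n <= p + d)%N & intertwines pi S].
Proof.
move=> Gd N; have [k] := ubnP N; elim: k N => // k IH N; rewrite ltnS => Nk.
move=> n pi piR nN.
have [Nd|dN] := leqP N d.
  exists 0%N, 0; split => //; first exact: leq_trans nN Nd.
  by split=> [|g]; [apply/matrixP; case|exists 0; rewrite !mulmx0].
have [V [Vinv V0 VT]] : exists V : {vspace 'cV[C]_N},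
    [/\ invariant_subspace pi V, V <> 0%VS & V <> fullv].
  apply: contrapT => noV.
  have /Gd : irreducible_rep pi; last by rewrite leqNgt dN.
  split=> [|//|V Vinv]; first exact: leq_ltn_trans dN.
  have [V0|V0] := pselect (V = 0%VS); first by left.
  have [VT|VT] := pselect (V = fullv); first by right.
  by exfalso; apply: noV; exists V.
have [a [b [S [S' [a0 b0 abN SS' [SI S'I]]]]]] := invariant_split piR Vinv V0 VT.
have aN : (a < k)%N by apply: leq_trans Nk; rewrite -abN -ltn_subLR ?subnn.
have bN : (b < k)%N by apply: leq_trans Nk; rewrite -abN addnC -ltn_subLR ?subnn.
have [na|an] := leqP n a.
  have [p [T [pn np TI]]] := IH a aN n _ (subrepresentation piR SI) na.
  by exists p, (S *m T); split => //; exact: intertwines_comp.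
have nb : (n - a <= b)%N by rewrite leq_subLR abN.
have [p [T [pn np TI]]] := IH b bN _ _ (subrepresentation piR S'I) nb.
exists (a + p)%N, (row_mx S (S' *m T)); split.
- by rewrite -(subnKC (ltnW an)) leq_add2l.
- by rewrite -addnA -leq_subLR.
- apply: intertwines_row_mx => //; last exact: intertwines_comp.
  by rewrite mulmxA SS' mul0mx.
Qed.

End Subrepresentations.

(** * Stability under a bound on irreducible dimensions *)

Section Corners.
Variable R : realType.
Local Notation C := R[i].

Lemma sq_sub_proj N p q (S : 'M[C]_(N, p)) (A : 'M[C]_(N, q)) : S^t* *m S = 1%:M ->
  sqnorm (A - S *m (S^t* *m A)) = sqnorm A - sqnorm (S^t* *m A).
Proof.
move=> SS; rewrite sqB sq_isom //.
have -> : dot A (S *m (S^t* *m A)) = sqnorm (S^t* *m A).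
  by rewrite -dotxx dot_mull trmxCK.
by move: (sqnorm A) (sqnorm _) => a b; ring.
Qed.

Lemma sq_coisometry_le N p q (S : 'M[C]_(N, p)) (A : 'M[C]_(N, q)) :
  S^t* *m S = 1%:M -> sqnorm (S^t* *m A) <= sqnorm A.
Proof. by move=> SS; rewrite -subr_ge0 -sq_sub_proj // sq_ge0. Qed.

(** The part of [W] that is lost is [Q W], where the projection [Q] has rank [N - p] and
    [W^*] is a contraction. *)
Lemma sq_corner N p q (S : 'M[C]_(N, p)) (W : 'M[C]_(N, q)) : S^t* *m S = 1%:M ->
  (forall r (u : 'M[C]_(N, r)), sqnorm (W^t* *m u) <= sqnorm u) ->
  sqnorm W - (N%:R - p%:R) <= sqnorm (S^t* *m W).
Proof.
move=> SS Wc; pose Q := 1%:M - S *m S^t*.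
have sqQ : sqnorm Q = N%:R - p%:R.
  have := sq_sub_proj 1%:M SS; rewrite !mulmx1 sq1 sq_adj => ->.
  by rewrite sq_isometry.
have Qadj : Q^t* = Q by rewrite trmxCD trmxCN trmxC1 trmxCM trmxCK.
have : sqnorm (Q *m W) <= N%:R - p%:R.
  by rewrite -sqQ -sq_adj trmxCM Qadj; exact: Wc.
rewrite mulmxBl mul1mx -mulmxA sq_sub_proj // lerBlDl => h.
by rewrite lerBlDl addrC.
Qed.

Lemma hsnorm_lt n (A : 'M[C]_n) (delta : R) : (0 < n)%N -> 0 < delta ->
  (hsnorm A < delta) = (sqnorm A < delta ^+ 2 * n%:R).
Proof.
move=> n0 d0; rewrite /hsnorm -[complex.Re _]/(dot A A) dotxx.
rewrite -[X in _ < X](gtr0_norm d0) -sqrtr_sqr ltr_sqrt ?exprn_gt0 //.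
by rewrite mulrC ltr_pdivrMr // ltr0n.
Qed.

End Corners.

Section InvariantMean.
Import numFieldNormedType.Exports.
Variable R : realType.

Lemma bnd_bounded_fun (T : Type) (f : T -> R) : bnd f -> bounded_fun f.
Proof.
move=> [K fK]; exists K; split; first exact: num_real.
by move=> M KM x _; exact: le_trans (fK x) (ltW KM).
Qed.

Lemma invariant_meanE (G : groupType) (m : (G -> R) -> R) : invariant_mean m ->
  mean m /\ forall (g : G) (f : G -> R), bnd f -> m (fun x => f (g * x)%g) = m f.
Proof.
move=> [lin pos m1 inv]; split; last by move=> g f /bnd_bounded_fun; exact: inv.
split => //; last by move=> f /bnd_bounded_fun; exact: pos.
by move=> a f g /bnd_bounded_fun fb /bnd_bounded_fun gb; exact: lin.
Qed.

End InvariantMean.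

Section Rounding.
Opaque sqnorm dot cmean meansq mxmean gram.
Variables (R : realType) (G : groupType).
Local Notation C := R[i].

(** A map close to a corner of a representation [pi] is close to a representation: cut
    [pi] down to the invariant subspace [S], fill up the dimension with a trivial
    representation, and conjugate by the unitary part of the almost intertwiner. *)
Lemma round_corner p k (phi : G -> 'M[C]_(p + k)) N (pi : G -> 'M[C]_N)
    (W : 'M[C]_(N, p + k)) (S : 'M[C]_(N, p)) (a b c : R) :
  (forall g, phi g \is unitarymx) -> unitary_rep pi -> intertwines pi S ->
  (forall q (u : 'M[C]_(N, q)), sqnorm (W^t* *m u) <= sqnorm u) ->
  (p + k)%:R - a <= sqnorm W -> N%:R - p%:R <= b ->
  (forall g, sqnorm (pi g *m W - W *m phi g) <= c) ->
  exists2 pi' : G -> 'M[C]_(p + k), unitary_rep pi' &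
    forall g, sqnorm (phi g - pi' g) <= 6 * (a + b) + 3 * c.
Proof.
have combine (x y z : R) : x <= a + b -> y <= c -> z <= a + b ->
    3 * (x + y + z) <= 6 * (a + b) + 3 * c by lra.
have combine2 (n x y z : R) : n - a <= x -> y <= b -> x - y <= z ->
    n - z <= a + b by lra.
move=> phiU piR SI Wc Wa Nb piW.
have [SS _] := SI; have [rU rM] := subrepresentation piR SI.
pose big g := block_mx (S^t* *m pi g *m S) 0 0 (1%:M : 'M[C]_k).
pose X := col_mx (S^t* *m W) (0 : 'M[C]_(k, p + k)).
have Xc q (u : 'M[C]_(p + k, q)) : sqnorm (X^t* *m u) <= sqnorm u.
  rewrite -[u]vsubmxK /X tr_col_mx map_row_mx mul_row_col trmxC0 mul0mx addr0.
  rewrite trmxCM trmxCK -mulmxA; apply: le_trans (Wc _ _) _.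
  by rewrite sq_isom // sq_col_mx lerDl sq_ge0.
have Xsq : sqnorm X = sqnorm (S^t* *m W) by rewrite sq_col_mx sq0 addr0.
have [U Uu UX] := polar_approx Xc.
have Uab : sqnorm (U - X) <= a + b.
  apply: le_trans UX _; rewrite Xsq.
  exact: combine2 Wa Nb (sq_corner SS Wc).
have bigU g : big g \is unitarymx.
  apply/unitarymxP; rewrite /big tr_block_mx map_block_mx mulmx_block.
  rewrite !trmxC0 !trmxC1 !mulmx0 !mul0mx !mulmx1 !addr0 !add0r.
  by rewrite (unitary_ctr (rU g)) -scalar_mx_block.
have bigM g h : big (g * h)%g = big g *m big h.
  rewrite /big mulmx_block !mulmx0 !mul0mx !mulmx1 !addr0 !add0r.
  by rewrite rM.
have UI : intertwines big U.
  split=> [|g]; first exact: unitary_ctl.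
  by exists (U^t* *m big g *m U); rewrite !mulmxA (unitary_ctr Uu) mul1mx.
exists (fun g => U^t* *m big g *m U).
  exact: (subrepresentation (conj bigU bigM) UI).
move=> g.
have -> : sqnorm (phi g - U^t* *m big g *m U) =
    sqnorm ((U - X) *m phi g + (X *m phi g - big g *m X) + big g *m (X - U)).
  rewrite -[LHS](sq_isom (S := U)) ?(unitary_ctl Uu) //; congr sqnorm.
  rewrite !mulmxBr mulmxBl !mulmxA (unitary_ctr Uu) mul1mx.
  by rewrite !addrA !subrK.
apply: le_trans (sqD3_le _ _ _) _; apply: combine.
- by rewrite sq_isomr // (unitary_ctr (phiU g)).
- apply: le_trans (piW g); rewrite -sqN opprB.
  have -> : big g *m X - X *m phi g = col_mx (S^t* *m (pi g *m W - W *m phi g)) 0.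
    rewrite /big /X mul_block_col mul_col_mx !mulmx0 !mul0mx !addr0.
    rewrite opp_col_mx add_col_mx subr0; congr col_mx.
    rewrite (mulmxA (S^t* *m pi g *m S)) -(adj_intertwinesE g piR SI).
    by rewrite mulmxBr -(mulmxA _ (pi g)) -(mulmxA _ W).
  by rewrite sq_col_mx sq0 addr0; exact: sq_coisometry_le.
- by rewrite sq_isom ?(unitary_ctl (bigU g)) // -sqN opprB.
Qed.

(** An excess of dimension [N > n] can only occur when [4 e n >= 1], so the loss of up
    to [d] dimensions in choosing an invariant subspace is at most [4 d e n]: the
    final error is proportional to [e n], uniformly in [n]. *)
Lemma stability_estimate d n (phi : G -> 'M[C]_n) (e : R) :
  amenable R G -> irreps_dim_le R G d -> 0 <= e ->
  (forall g, phi g \is unitarymx) ->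
  (forall g h, sqnorm (phi g *m phi h - phi (g * h)%g) <= e * n%:R) ->
  exists2 pi : G -> 'M[C]_n, unitary_rep pi &
    forall g, sqnorm (phi g - pi g) <= (90 + 24 * d%:R) * (e * n%:R).
Proof.
have final (x : R) : 6 * (5 * e * x + (4 + 4 * d%:R) * (e * x)) + 3 * (12 * e * x) =
  (90 + 24 * d%:R) * (e * x) by ring.
(* [x] stands for [n]. *)
have codim (x N p : R) : N <= (1 + 4 * e) * x -> x + 1 <= N -> x <= p + d%:R ->
    N - p <= (4 + 4 * d%:R) * (e * x).
  move=> h1 h2 h3; have h4 : 0 <= d%:R * (4 * (e * x) - 1).
    by rewrite mulr_ge0 //; lra.
  move: h1 h2 h3 h4; move: (d%:R) => y; lra.
move=> [m /invariant_meanE [mP minv]] Gd e0 phiU phie.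
have [N [pi [W [NK piR Wsq Wc piW]]]] := exact_dilation mP minv phiU phie.
have [p [S [pn Np SI]]] : exists p (S : 'M[C]_(N, p)),
    [/\ (p <= n)%N, N%:R - p%:R <= (4 + 4 * d%:R) * (e * n%:R) & intertwines pi S].
  have [Nn|nN] := leqP N n.
    exists N, 1%:M; split => //.
      by rewrite subrr mulr_ge0 ?addr_ge0 ?mulr_ge0.
    split; first by rewrite trmxC1 mulmx1.
    by move=> g; exists (pi g); rewrite mulmx1 mul1mx.
  have [p [S [pn np SI]]] := invariant_subspace_of_dim Gd piR (ltnW nN).
  exists p, S; split => //; apply: codim => //.
    by rewrite natr1 ler_nat.
  by rewrite -natrD ler_nat.
have [k nE] : exists k, n = (p + k)%N by exists (n - p)%N; rewrite subnKC.
subst n; rewrite -final.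
exact: round_corner phiU piR SI Wc Wsq Np piW.
Qed.

End Rounding.

(** * Irreducible representations of large dimension *)

Section Converse.
Opaque sqnorm dot cmean meansq mxmean gram.
Variables (R : realType) (G : groupType) (m : (G -> R) -> R) (mP : mean m).
Hypothesis minv : forall (g : G) (f : G -> R), bnd f -> m (fun x => f (g * x)%g) = m f.
Local Notation C := R[i].

(** Averaging [x |-> pi x S (rho x)^-1] turns any matrix [S] into an intertwiner, which is
    nonzero when [S] almost intertwines; irreducibility of [pi] then forces
    the dimension of [rho] to be at least that of [pi]. *)
Lemma no_near_intertwiner n N (pi : G -> 'M[C]_n) (rho : G -> 'M[C]_N)
    (S : 'M[C]_(n, N)) (a : R) :
  irreducible_rep pi -> unitary_rep rho -> (N < n)%N -> 0 < a ->
  ~ forall g, a <= dot (pi g *m S *m (rho g)^t*) S.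
Proof.
move=> [n0 piR irr] rhoR Nn a0 near.
have [piU piM] := piR; have [rhoU rhoM] := rhoR.
pose F g := pi g *m S *m (rho g)^t*.
have Fb : mbnd F.
  apply: mbndM; first by apply: mbndMc; apply: (@sq_mbnd _ _ _ _ n%:R) => g;
    rewrite (sq_isometry (unitary_ctl (piU g))).
  apply: mbndC; apply: (@sq_mbnd _ _ _ _ N%:R) => g.
  by rewrite (sq_isometry (unitary_ctl (rhoU g))).
pose T := mxmean m F.
have T0 : T != 0.
  apply/eqP => T0; have : a <= dot T S.
    rewrite (mxmean_dot mP S Fb) -[leLHS](mean_cst mP); apply: (mean_le mP) => //.
      exact: bnd_cst.
    by apply: mbnd_dot => //; exact: mbnd_cst.
  by rewrite T0 dot0l leNgt a0.
have TI h : pi h *m T = T *m rho h.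
  have : pi h *m T *m (rho h)^t* = T.
    rewrite -(mxmean_mull mP) // -(mxmean_mulr mP); last first.
      by apply: mbndM => //; exact: mbnd_cst.
    have -> : (fun x => pi h *m F x *m (rho h)^t*) = (fun x => F (h * x)%g).
      by apply/funext => x; rewrite /F piM rhoM trmxCM !mulmxA.
    exact: (mxmean_translate minv h Fb).
  move/(congr1 (mulmx^~ (rho h))).
  by rewrite -mulmxA (unitary_ctl (rhoU h)) mulmx1.
(* The range of [T] is invariant, nonzero, and too small to be everything. *)
pose V := limg (linfun (mulmx T : 'cV[C]_N -> 'cV[C]_n)).
have TV u : T *m u \in V.
  by have := memv_img (linfun (mulmx T : 'cV[C]_N -> 'cV[C]_n)) (memvf u); rewrite lfunE.
have Vinv : invariant_subspace pi V.
  move=> g v /memv_imgP [u _ ->]; rewrite lfunE /= mulmxA TI -mulmxA.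
  exact: TV.
have [V0|VT] := irr V Vinv.
  case/eqP: T0; apply/matrixP => i j; rewrite mxE.
  have : T *m delta_mx j 0 \in V by exact: TV.
  rewrite V0 memv0 -colE => /eqP /(congr1 (fun A : 'cV[C]_n => A i 0)).
  by rewrite !mxE.
have /choice [u uP] : forall i, exists u : 'cV[C]_N, T *m u = delta_mx i 0.
  move=> i; have : (delta_mx i 0 : 'cV[C]_n) \in V by rewrite VT memvf.
  by move=> /memv_imgP [u _ ->]; exists u; rewrite lfunE.
have : T *m (\matrix_(k, i) u i k 0) = 1%:M.
  apply/matrixP => k i; have := congr1 (fun A : 'cV[C]_n => A k 0) (uP i).
  rewrite !mxE eqxx andbT => <-.
  by apply: eq_bigr => l _; rewrite !mxE.
by move/mulmx1_min; rewrite leqNgt Nn.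
Qed.

(** Compressing an irreducible representation to a hyperplane costs almost nothing in
    normalised norm, but no representation of the smaller dimension is near. *)
Lemma irreps_bounded : uniformly_HS_stable R G -> exists d, irreps_dim_le R G d.
Proof.
move=> st; apply: contrapT => unbounded.
have [|eps eps0 stab] := st 2^-1; first by rewrite invr_gt0.
(* The unitary parts of the compressions have squared multiplicativity error at most
   16 in unnormalised norm, coming from four terms of square at most 1. *)
pose K := (Num.bound (16 / eps ^+ 2) + 3)%N.
have [n [pi [pirr Kn]]] : exists n (pi : G -> 'M[C]_n), irreducible_rep pi /\ (K < n)%N.
  apply: contrapT => H; apply: unbounded; exists K => n pi pirr.
  by rewrite leqNgt; apply/negP => Kn; apply: H; exists n, pi.
have [N nE] : exists N, n = (N + 1)%N.
  by exists n.-1; rewrite addn1 prednK // (leq_ltn_trans _ Kn).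
subst n.
have [n0 piR _] := pirr; have [piU piM] := piR.
have KN : (K <= N)%N by move: Kn; rewrite addn1 ltnS.
have N3 : 3 <= N%:R :> R.
  by rewrite ler_nat; apply: leq_trans KN; rewrite leq_addl.
have Neps : 16 < eps ^+ 2 * N%:R.
  have e2 : 0 < eps ^+ 2 by rewrite exprn_gt0.
  rewrite mulrC -ltr_pdivrMr //; apply: lt_le_trans (archi_boundP _) _.
    by rewrite divr_ge0 // ltW.
  by rewrite ler_nat; apply: leq_trans KN; rewrite leq_addr.
pose S : 'M[C]_(N + 1, N) := col_mx 1%:M 0.
have SS : S^t* *m S = 1%:M.
  by rewrite tr_col_mx map_row_mx mul_row_col trmxC1 trmxC0 mul0mx addr0 mulmx1.
pose X g := S^t* *m pi g *m S.
have drop q (A : 'M[C]_(N + 1, q)) : (forall r (u : 'M[C]_(N + 1, r)), sqnorm (A^t* *m u) <= sqnorm u) ->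
    sqnorm A - 1 <= sqnorm (S^t* *m A).
  by move/(sq_corner SS); rewrite natrD [_ + 1]addrC addrK.
have piSc g r (u : 'M[C]_(N + 1, r)) : sqnorm ((pi g *m S)^t* *m u) <= sqnorm u.
  rewrite trmxCM -mulmxA; apply: le_trans (sq_coisometry_le _ SS) _.
  by rewrite sq_isom // trmxCK (unitary_ctr (piU g)).
have piS g : sqnorm (pi g *m S) = N%:R.
  by rewrite sq_isom ?(unitary_ctl (piU g)) // (sq_isometry SS).
have Xsq g : N%:R - 1 <= sqnorm (X g).
  by rewrite -(piS g) /X -mulmxA; exact: drop.
have Xc g r (u : 'M[C]_(N, r)) : sqnorm ((X g)^t* *m u) <= sqnorm u.
  rewrite /X -mulmxA trmxCM trmxCK -mulmxA; apply: le_trans (piSc _ _ _) _.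
  by rewrite sq_isom.
have Xcl g r (u : 'M[C]_(N, r)) : sqnorm (X g *m u) <= sqnorm u.
  rewrite /X -!mulmxA; apply: le_trans (sq_coisometry_le _ SS) _.
  by rewrite sq_isom ?(unitary_ctl (piU g)) // sq_isom.
have /choice [phi phiP] : forall g, exists U : 'M[C]_N, U \is unitarymx /\ sqnorm (U - X g) <= 1.
  move=> g; have [U Uu UX] := polar_approx (Xc g); exists U; split => //.
  by apply: le_trans UX _; rewrite lerBlDr addrC -lerBlDr.
have phiU g := (phiP g).1; have phiX g := (phiP g).2.
have XM g h : sqnorm (X g *m X h - X (g * h)%g) <= 1.
  have -> : X g *m X h - X (g * h)%g =
      - (S^t* *m pi g *m (pi h *m S - S *m (S^t* *m (pi h *m S)))).
    by rewrite mulmxBr /X piM opprB !mulmxA.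
  rewrite sqN -mulmxA; apply: le_trans (sq_coisometry_le _ SS) _.
  rewrite sq_isom ?(unitary_ctl (piU g)) // sq_sub_proj // lerBlDr addrC -lerBlDr.
  exact: drop.
have four (x y z w : R) : x <= 1 -> y <= 1 -> z <= 1 -> w <= 1 ->
  2 * (2 * (x + y) + 2 * (z + w)) <= 16 by lra.
have phiM g h : sqnorm (phi g *m phi h - phi (g * h)%g) <= 16.
  have -> : phi g *m phi h - phi (g * h)%g =
      ((phi g - X g) *m phi h + X g *m (phi h - X h)) +
      ((X g *m X h - X (g * h)%g) + (X (g * h)%g - phi (g * h)%g)).
    by rewrite mulmxBl mulmxBr !addrA !subrK.
  apply: le_trans (sqD_le _ _) _.
  apply: le_trans (four _ _ _ _ (phiX g) (phiX h) (XM g h) (phiX (g * h)%g)).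
  rewrite ler_pM2l //; apply: lerD; apply: le_trans (sqD_le _ _) _; rewrite ler_pM2l //.
    by apply: lerD; [rewrite sq_isomr // (unitary_ctr (phiU h))|exact: Xcl].
  by rewrite -(sqN (X _ - _)) opprB.
have N0 : (0 < N)%N by rewrite -(ltr_nat R); exact: lt_le_trans N3.
have phiH : eps_hom eps phi.
  split=> // g h; rewrite hsnorm_lt //; exact: le_lt_trans (phiM g h) Neps.
have [rho rhoR near] := stab G N phi erefl N0 phiH.
have [rhoU _] := rhoR.
have N_lt : (N < N + 1)%N by rewrite addn1.
have low (x y z t D : R) : 3 <= x -> x - 1 <= y -> z <= 1 -> t < 2^-1 ^+ 2 * x ->
  y + x - 2 * D <= 2 * (z + t) -> 1 / 2 <= D by rewrite exprVn; lra.
apply: (@no_near_intertwiner _ _ pi rho S (1 / 2) pirr rhoR N_lt) => [|g]; first by rewrite divr_gt0.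
have -> : dot (pi g *m S *m (rho g)^t*) S = dot (X g) (rho g).
  by rewrite dot_mulr trmxCK /X -mulmxA [RHS]dot_mull trmxCK.
have phig := near g; rewrite hsnorm_lt ?invr_gt0 // in phig.
apply: (low _ _ _ _ _ N3 (Xsq g) (phiX g) phig).
rewrite -[X in _ + X - _ <= _](sq_isometry (unitary_ctl (rhoU g))) -sqB.
have -> : X g - rho g = (X g - phi g) + (phi g - rho g) by rewrite addrA subrK.
by rewrite -(sqN (phi g - X g)) opprB; exact: sqD_le.
Qed.

End Converse.

Theorem theorem1p6 (R : realType) :
  (forall d : nat,
     uniformly_stable R (fun G : groupType =>
       [/\ countable [set: G]%classic, amenable R G & irreps_dim_le R G d]))
  /\
  (forall Gamma : groupType,
     countable [set: Gamma]%classic -> amenable R Gamma ->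
     (uniformly_HS_stable R Gamma <->
      exists d : nat, irreps_dim_le R Gamma d)).
Proof.
have stable d : uniformly_stable R (fun G : groupType =>
    [/\ countable [set: G]%classic, amenable R G & irreps_dim_le R G d]).
  (* [k] is chosen so that [k ^ 2] exceeds the constant of [stability_estimate]. *)
  move=> delta delta0; pose k : R := 10 + 5 * d%:R.
  have k0 : 0 < k by rewrite ltr_wpDr // mulr_ge0.
  have kd : 90 + 24 * d%:R < k ^+ 2.
    have : 0 <= d%:R :> R by [].
    by rewrite /k; move: (d%:R) => y y0; nra.
  exists (delta / k) => [|G n phi [_ Gam Gd] n0 [phiU phiM]]; first exact: divr_gt0.
  have n0R : 0 < n%:R :> R by rewrite ltr0n.
  have eps0 : 0 < delta / k by exact: divr_gt0.
  have phie g h : sqnorm (phi g *m phi h - phi (g * h)%g) <= (delta / k) ^+ 2 * n%:R.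
    by have := phiM g h; rewrite hsnorm_lt // => /ltW.
  have [pi piR near] := stability_estimate Gam Gd (sqr_ge0 (delta / k)) phiU phie.
  exists pi => // g; rewrite hsnorm_lt //; apply: le_lt_trans (near g) _.
  rewrite mulrA ltr_pM2r // exprMn exprVn mulrCA gtr_pMr ?exprn_gt0 //.
  by rewrite ltr_pdivrMr ?mul1r // exprn_gt0.
split=> // Gamma countG Gam; split.
  have [m /invariant_meanE [mP minv]] := Gam.
  exact: (irreps_bounded mP minv).
move=> [d Gd] delta delta0; have [eps eps0 epsP] := stable d delta delta0.
by exists eps => // G n phi GE; apply: epsP; rewrite GE.
Qed.
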